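(* Let $w\in S_n$. Then $$\dim\left(\overline{X_w^{\mathrm{low}}}\right)=\dim\left(\overline{X_w^{\mathrm{sym}}}\right)=\dim\left(\overline{X_w}\right)-\binom n2 .$$
   Context: $w$ is identified with the permutation matrix with $1$s at $(w(j),j)$; $r_M(a,b)$ is the rank of the submatrix of $M$ with rows $a,\dots,n$ and columns $1,\dots,b$. $D^\circ(w)=\{(i,j): w(j)<i,\ w^{-1}(i)>j\}$ and $\mathrm{Ess}(w)$ is the set of north-east corners of its connected components. The matrix Schubert variety is $\overline{X_w}=\overline{BwB}\subseteq\mathbb C^{n\times n}$ ($B$ the upper triangular invertible matrices); it is defined by the Fulton conditions $r_M(a,b)\le r_w(a,b)$ for $(a,b)\in\mathrm{Ess}(w)$ (vanishing of the minors of size $r_w(a,b)+1$ of the corresponding submatrices) and has dimension $n^2-|D^\circ(w)|$. The symmetric matrix Schubert variety $\overline{X_w^{\mathrm{sym}}}$ is the variety of the ideal generated by imposing the Fulton conditions on a generic symmetric $n\times n$ matrix; the lower triangular matrix Schubert variety $\overline{X_w^{\mathrm{low}}}$ is the variety of the ideal generated by imposing the Fulton conditions on a generic lower triangular $n\times n$ matrix. *)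

(* Defs.v *)
From HB Require Import structures.
From mathcomp Require Import all_boot all_order all_fingroup all_algebra.
From mathcomp Require Import classical_sets reals.
From mathcomp Require Import complex mpoly.

Set Implicit Arguments.
Unset Strict Implicit.
Unset Printing Implicit Defensive.

Import Order.TTheory GRing.Theory Num.Theory.

Local Open Scope classical_set_scope.
Local Open Scope ring_scope.

(* Points of the affine space F^m are row vectors. *)
Section Zariski.
Variables (F : fieldType) (m : nat).
Implicit Types (S : set {mpoly F[m]}) (X Y Z : set 'rV[F]_m).

Definition gen_ideal S : set {mpoly F[m]} :=
  [set p | exists2 r : seq ({mpoly F[m]} * {mpoly F[m]}),
     (forall c, c \in r -> S c.2) & p = \sum_(c <- r) c.1 * c.2].

Definition zero_locus S : set 'rV[F]_m :=
  [set v | forall p, S p -> p.@[v 0] = 0].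

Definition zclosed X := exists S, X = zero_locus S.

Definition zclosure X : set 'rV[F]_m :=
  [set v | forall Y, zclosed Y -> X `<=` Y -> Y v].

Definition zirreducible X :=
  X !=set0 /\
  forall Y Z, zclosed Y -> zclosed Z -> X `<=` Y `|` Z -> X `<=` Y \/ X `<=` Z.

(* T 0, ..., T d are irreducible closed subsets of X, strictly increasing. *)
Definition zchain X d (T : nat -> set 'rV[F]_m) :=
  (forall k, (k <= d)%N -> [/\ zclosed (T k), zirreducible (T k) & T k `<=` X])
  /\ (forall k, (k < d)%N -> T k `<` T k.+1).

(* Krull dimension of a Zariski closed set X. No d satisfies zdim set0 d. *)
Definition zdim X (d : nat) :=
  (exists T, zchain X d T) /\ (forall e T, zchain X e T -> (e <= d)%N).

Lemma zdim_uniq X d e : zdim X d -> zdim X e -> d = e.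
Proof.
move=> [[T hT] hd] [[T' hT'] he]; apply/eqP; rewrite eqn_leq.
by rewrite (he _ _ hT) (hd _ _ hT').
Qed.

End Zariski.

(* Boxes are pairs (row, column), numbered from 0; rows increase southwards. *)
Section Diagram.
Variables (n : nat) (w : 'S_n).
Implicit Types (p q : 'I_n * 'I_n) (C : {set 'I_n * 'I_n}).

Definition dcirc : {set 'I_n * 'I_n} :=
  [set p : 'I_n * 'I_n | (w p.2 < p.1)%N && (p.2 < (w^-1)%g p.1)%N]%SET.

Definition north_of p q := (p.1.+1 == q.1 :> nat) && (p.2 == q.2).
Definition east_of p q := (p.1 == q.1) && (p.2 == q.2.+1 :> nat).

Definition box_adj : rel ('I_n * 'I_n) := fun p q =>
  [&& p \in dcirc, q \in dcirc &
      [|| north_of p q, north_of q p, east_of p q | east_of q p]].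

Definition dcirc_components : {set {set 'I_n * 'I_n}} :=
  equivalence_partition (connect box_adj) dcirc.

Definition ne_corners C : {set 'I_n * 'I_n} :=
  [set p in C | [forall q in C, ~~ north_of q p && ~~ east_of q p]]%SET.

Definition ess : {set 'I_n * 'I_n} :=
  (\bigcup_(C in dcirc_components) ne_corners C)%SET.

End Diagram.

(* The south-west submatrix: rows >= a and columns <= b. *)
Definition swsub (R : Type) n (a b : 'I_n) (M : 'M[R]_n) :
    'M[R]_(#|[pred i : 'I_n | (a <= i)%N]|, #|[pred j : 'I_n | (j <= b)%N]|) :=
  mxsub enum_val enum_val M.

Definition swrank (F : fieldType) n (M : 'M[F]_n) (a b : 'I_n) : nat :=
  \rank (swsub a b M).

(* The 1s are at (w j, j): this is the transpose of perm_mx w. *)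
Definition wmx (F : fieldType) n (w : 'S_n) : 'M[F]_n :=
  \matrix_(i, j) (i == w j)%:R.

Definition minors (R : comNzRingType) k p q (N : 'M[R]_(p, q)) : set R :=
  [set x | exists (f : 'I_k -> 'I_p) (g : 'I_k -> 'I_q),
     [/\ {homo f : i j / (i < j)%N}, {homo g : i j / (i < j)%N}
       & x = \det (mxsub f g N)]].

Section Varieties.
Variable F : fieldType.

Definition borel {n} : set 'M[F]_n :=
  [set b | b \in unitmx /\ forall i j : 'I_n, (j < i)%N -> b i j = 0].

Definition bruhat_cell n (w : 'S_n) : set 'M[F]_n :=
  [set M | exists b1 b2,
     [/\ borel b1, borel b2 & M = b1 *m wmx F w *m b2]].

(* F^(n x n) is identified with F^(n * n) through mxvec. *)
Definition matrix_schubert n (w : 'S_n) : set 'rV[F]_(n * n) :=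
  zclosure [set mxvec M | M in bruhat_cell w].

(* The Fulton conditions imposed on a matrix G of polynomials in m variables. *)
Definition fulton_generators n (w : 'S_n) m (G : 'M[{mpoly F[m]}]_n) :
    set {mpoly F[m]} :=
  [set p | exists2 c : 'I_n * 'I_n, c \in ess w &
     minors (swrank (wmx F w) c.1 c.2).+1 (swsub c.1 c.2 G) p].

Definition fulton_variety n (w : 'S_n) m (G : 'M[{mpoly F[m]}]_n) :
    set 'rV[F]_m :=
  zero_locus (gen_ideal (fulton_generators w G)).

(* The positions on or below the diagonal index the n(n+1)/2 variables of the
   generic lower triangular and of the generic symmetric matrix. *)
Definition low_pos n := {p : 'I_n * 'I_n | (p.2 <= p.1)%N}.

Definition low_var n (i j : 'I_n) : {mpoly F[#|{: low_pos n}|]} :=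
  if insub (i, j) is Some p then 'X_(enum_rank (p : low_pos n)) else 0.

Definition generic_low n : 'M[{mpoly F[#|{: low_pos n}|]}]_n :=
  \matrix_(i, j) low_var i j.

Definition generic_sym n : 'M[{mpoly F[#|{: low_pos n}|]}]_n :=
  \matrix_(i, j) if (j <= i)%N then low_var i j else low_var j i.

Definition low_schubert n (w : 'S_n) := fulton_variety w (generic_low n).

Definition sym_schubert n (w : 'S_n) := fulton_variety w (generic_sym n).

End Varieties.

Arguments bruhat_cell F {n} w _.
Arguments matrix_schubert F {n} w _.
Arguments low_schubert F {n} w _.
Arguments sym_schubert F {n} w _.

(* Main.v *)
Require Import Defs.
From HB Require Import structures.
From mathcomp Require Import all_boot all_order all_fingroup all_algebra.
From mathcomp Require Import boolp classical_sets reals.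
From mathcomp Require Import complex mpoly.
From mathcomp Require Import zify.

(* Let l be the number of inversions of w, so that |D°(w)| = C(n, 2) - l; the
   dimensions are n + l, n + l and n + C(n, 2) + l.

   Lower bounds. Let L(t) be the product of the elementary matrices
   1 + t_k E_(i+1,i) along a reduced word of w; it lies in B w B when all t_k are
   nonzero. With D diagonal and U upper triangular, L(t) D, L(t) D L(t)^T and
   L(t) U parametrize parts of the three varieties, and setting the parameters to
   0 one by one gives a chain of irreducible closed sets. It is strict because
   removing the last letter of a reduced word lowers one south-west rank.

   Upper bounds. A set on which any d + 1 polynomials are algebraically dependent
   has dimension at most d. The dependence follows by counting the monomials that
   are not divisible by the diagonal term of a Fulton minor: the support F of such
   a monomial contains no chain of r_w(a,b) + 1 boxes going south-east in the
   region of (a, b). Reading the boxes as a wiring diagram in which the boxes of F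
   are bounces and the others crossings yields a permutation of 2n strands lying
   below w in the Bruhat order, so that F misses at least |D°(w)| boxes.
   In the triangular and symmetric cases, the strictly upper triangular boxes can
   be added to F, since a chain that long never meets them. *)

Set Implicit Arguments.
Unset Strict Implicit.
Unset Printing Implicit Defensive.

Import Order.TTheory GRing.Theory Num.Theory.

(** * Non-inversions and the Bruhat order *)

Section Noninversions.
Variable N : nat.
Implicit Types (u w : 'S_N) (i j k q : 'I_N).
Local Open Scope nat_scope.

Definition noninvs u : {set 'I_N * 'I_N} :=
  [set p : 'I_N * 'I_N | (p.1 < p.2) && (u p.1 < u p.2)].

(** The non-inversions of the swapped permutation embed into those of [u] other than [(j, k)]: a
    pair is moved by the transposition if this keeps its order, and stays in place otherwise. *)
Lemma card_noninvs_swap u j k : j < k -> u j < u k ->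
  #|noninvs (tperm j k * u)%g| < #|noninvs u|.
Proof.
move=> jk ujk; set t := tperm j k.
pose f (p : 'I_N * 'I_N) := if t p.1 < t p.2 then (t p.1, t p.2) else p.
have Hjk : (j, k) \in noninvs u by rewrite inE /= jk ujk.
rewrite [#|noninvs u|](cardsD1 (j, k)) Hjk add1n ltnS.
have tE x : (x = j /\ t x = k) \/ (x = k /\ t x = j) \/ [/\ x <> j, x <> k & t x = x].
  by rewrite /t; case: tpermP; [left|right; left|right; right].
have finj : {in noninvs (t * u)%g &, injective f}.
  move=> [x y] [x' y']; rewrite !inE /f /= => /andP[xy _] /andP[xy' _].
  case: ifP => h; case: ifP => h' // [] e1 e2.
  - by rewrite (perm_inj e1) (perm_inj e2).
  - by move: h'; rewrite -e1 -e2 /t !tpermK xy.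
  - by move: h; rewrite e1 e2 /t !tpermK xy'.
rewrite -(card_in_imset finj); apply: subset_leq_card; apply/fintype.subsetP => _ /imsetP [[x y] + ->].
rewrite inE /= !permM => /andP [xy uxy].
rewrite /f /=; case: ifPn => h; rewrite !inE /= ?xpair_eqE -!val_eqE /=.
  rewrite h uxy !andbT; apply/negP => /andP[/eqP e1 /eqP e2].
  have Ex : t (t x) = t j by congr (t _); apply: val_inj.
  have Ey : t (t y) = t k by congr (t _); apply: val_inj.
  by move: xy; rewrite -[x](tpermK j k) -[y](tpermK j k) Ex Ey tpermL tpermR; lia.
move: h uxy; rewrite -/t.
case: (tE x) => [[ex ->]|[[ex ->]|[ex1 ex2 ->]]]; case: (tE y) => [[ey ->]|[[ey ->]|[ey1 ey2 ->]]];
  rewrite ?ex ?ey in xy *; try subst x; try subst y; try lia;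
  move=> h uxy; rewrite xy /=.
- have ynk : val y != val k by rewrite val_eqE; apply/eqP.
  by rewrite (ltn_trans ujk uxy) andbT negb_and orbC [_ != _]ynk.
- have xnj : val x != val j by rewrite val_eqE; apply/eqP.
  by rewrite (ltn_trans uxy ujk) andbT negb_and [_ != _]xnj.
Qed.

(** For neighbouring positions the transposition reverses the order of the pair [(j, k)] alone; it
    transports all other pairs injectively. *)
Lemma card_noninvs_adj u j k : k = j.+1 :> nat ->
  #|noninvs (tperm j k * u)%g| <= #|noninvs u|.+1.
Proof.
move=> kj; set t := tperm j k.
have tE x : (x = j /\ t x = k) \/ (x = k /\ t x = j) \/ [/\ x <> j, x <> k & t x = x].
  by rewrite /t; case: tpermP; [left|right; left|right; right].
rewrite (cardsD1 (j, k)) -add1n leq_add ?leq_b1 //.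
pose f (p : 'I_N * 'I_N) := (t p.1, t p.2).
have finj : injective f by move=> [x y] [x' y'] [] /perm_inj -> /perm_inj ->.
rewrite -(card_imset _ finj); apply: subset_leq_card.
apply/fintype.subsetP => _ /imsetP [[x y] + ->].
rewrite !inE /= !permM xpair_eqE -!val_eqE /= => /and3P [nxy xy ->]; rewrite andbT -/t.
case: (tE x) => [[ex ->]|[[ex ->]|[/eqP ex1 /eqP ex2 ->]]];
case: (tE y) => [[ey ->]|[[ey ->]|[/eqP ey1 /eqP ey2 ->]]];
  try subst x; try subst y; rewrite -?val_eqE /= in nxy xy *; try lia;
  rewrite -?val_eqE /= in ex1 ex2 ey1 ey2 *; lia.
Qed.

Lemma card_noninvs_ascent u j k : k = j.+1 :> nat -> u j < u k ->
  #|noninvs u| = #|noninvs (tperm j k * u)%g|.+1.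
Proof.
move=> kj ujk; apply/eqP; rewrite eqn_leq card_noninvs_swap ?kj // andbT.
have := card_noninvs_adj (tperm j k * u) kj.
by rewrite mulgA tperm2 mul1g.
Qed.

(** The rank of the block of the permutation matrix of [u] formed by the rows from [a] on and the
    first [b] columns (see [swrank_wmx]). The column bound is exclusive, so [b = 0] is the empty
    block. *)
Definition cnt u b a := \sum_(q < N) ((q < b) && (a <= u q)).

Lemma sum_split3 (f : 'I_N -> nat) j :
  \sum_q f q = \sum_(q : 'I_N | q < j) f q + f j + \sum_(q : 'I_N | j < q) f q.
Proof.
rewrite (bigID (fun q : 'I_N => q < j)) /= -addnA; congr (_ + _).
rewrite (bigD1 j) ?ltnn //=; congr (_ + _); apply: eq_bigl => q.
by rewrite -val_eqE /=; lia.
Qed.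

Lemma cnt_tperm u j k b a : j < k -> (b <= j) || (k < b) ->
  cnt (tperm j k * u)%g b a = cnt u b a.
Proof.
move=> jk /orP[bj|kb]; rewrite /cnt.
  apply: eq_bigr => q _; rewrite permM; case: tpermP => [->|->|//].
    by rewrite !ltnNge bj.
  by rewrite !ltnNge (leq_trans bj (ltnW jk)).
rewrite [RHS](reindex_inj (@perm_inj _ (tperm j k))) /=; apply: eq_bigr => q _.
rewrite permM; case: tpermP => [->|->|//]; by rewrite kb (ltn_trans jk kb).
Qed.

(* If u and w first differ at j, then u j < w j, and exchanging u j with the
   first later value in the interval from u j to w j preserves the domination. *)
Lemma card_noninvs_bruhat u w :
  (forall b a, cnt u b a <= cnt w b a) -> #|noninvs w| <= #|noninvs u|.
Proof.
move En : #|noninvs u| => n; elim/ltn_ind: n u En => n IH u En H; rewrite -En.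
case: (pickP (fun j => u j != w j)) => [j0 hj0|h]; last first.
  suff -> : w = u by [].
  by apply/permP => q; move/negbFE/eqP: (h q).
have [j ujw jmin] := @arg_minnP _ j0 (fun j => u j != w j) val hj0.
have uw (q : 'I_N) : q < j -> u q = w q.
  by move=> qj; apply/eqP; apply: contraLR qj => /jmin; rewrite -leqNgt.
have ltuw : u j < w j.
  rewrite ltn_neqAle ujw /= leqNgt; apply/negP => wu.
  have := H j.+1 (u j); rewrite /cnt !(sum_split3 _ j).
  rewrite [X in X + _ + _](eq_bigr (fun q : 'I_N => ((q < j.+1) && (u j <= w q)) : nat)); last first.
    by move=> q /uw ->.
  have s0 v : \sum_(q : 'I_N | j < q) ((q < j.+1) && (u j <= v q)) = 0.
    by apply: big1 => q jq; rewrite ltnS leqNgt jq.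
  by rewrite !s0 ltnS !leqnn [u j <= w j]leqNgt wu /= !addn0 addn1 ltnn.
pose P (k : 'I_N) := (j < k) && (u j < u k <= w j).
have Pk0 : P (u^-1 (w j))%g.
  rewrite /P permKV leqnn ltuw !andbT ltnNge leq_eqVlt; apply/negP => /orP[/eqP e|lt].
    have e2 : (u^-1)%g (w j) = j by apply: val_inj.
    by move: ujw; rewrite -[in u j]e2 permKV eqxx.
  have := uw _ lt; rewrite permKV => /perm_inj e2.
  by move: lt; rewrite -e2 ltnn.
have [k /and3P[jk ujk ukw] kmin] := @arg_minnP _ _ P val Pk0.
have lt' := card_noninvs_swap jk ujk.
apply: leq_trans (ltnW lt').
rewrite En in lt'; apply: (IH _ lt' _ erefl) => b a.
have [bj|jb] := leqP b j; first by rewrite cnt_tperm ?bj.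
have [kb|bk] := ltnP k b; first by rewrite cnt_tperm ?kb ?orbT.
have [auk|auk] := leqP a (u k); last first.
  apply: leq_trans (H b a); apply: eq_leq; apply: eq_bigr => q _.
  by rewrite permM; case: tpermP => [->|->|//]; congr (nat_of_bool _); lia.
have [auj|auj] := leqP a (u j).
  apply: leq_trans (H b a); apply: eq_leq; apply: eq_bigr => q _.
  by rewrite permM; case: tpermP => [->|->|//]; congr (nat_of_bool _); lia.
(* What remains is [j < b <= k] and [u j < a <= u k]. By minimality of [k], a value of [u] that is
   at least [a] strictly between [j] and [b] exceeds [w j], so the domination at threshold [w j + 1]
   bounds these positions. *)
have := H b (w j).+1; rewrite /cnt !(sum_split3 _ j) permM tpermL jb auk ltnn andbF.
rewrite [w j < u j]ltnNge (ltnW ltuw) !andbF /= (leq_trans auk ukw).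
set A1 := (X in X + _ + _ <= _ -> _); set B1 := (X in _ <= X + _ + _ -> _).
have -> : A1 = B1 by apply: eq_bigr => q /uw ->.
set A2 := (X in _ -> X + _ + _ <= _); set B2 := (X in _ -> _ <= X + _ + _).
have -> : A2 = B2.
  apply: eq_bigr => q qj; rewrite permM tpermD ?uw //; rewrite -val_eqE /=; lia.
rewrite !addn0 leq_add2l leq_add2l => h.
apply: leq_trans (leq_trans h _); apply: leq_sum => q jq.
  rewrite permM; case: (ltnP q b) => //= qb.
  have qk : q < k := leq_trans qb bk.
  rewrite tpermD; last 2 first.
  - by rewrite -val_eqE neq_ltn jq.
  - by rewrite -val_eqE neq_ltn qk orbT.
  case: (leqP a (u q)) => //= auq; rewrite lt0b ltnNge; apply/negP => uqw.
  have : P q by rewrite /P jq uqw (leq_trans auj auq).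
  by move/kmin; rewrite leqNgt /= qk.
by case: (q < b) => //=; case: (ltnP (w j) (w q)) => //= ?; lia.
Qed.

Lemma sum_ord_lt b : \sum_(q < N) (q < b) = minn N b.
Proof.
elim: N => [|m IH]; first by rewrite big_ord0 min0n.
by rewrite big_ord_recr /= IH; lia.
Qed.

Lemma sum_ord_ge a : \sum_(q < N) (a <= q) = N - a.
Proof.
elim: N => [|m IH]; first by rewrite big_ord0.
by rewrite big_ord_recr /= IH; lia.
Qed.

Lemma cnt_le_pos u b a : cnt u b a <= minn N b.
Proof.
by rewrite -sum_ord_lt; apply: leq_sum => q _; case: (q < b); rewrite ?leq_b1.
Qed.

Lemma cnt_le_val u b a : cnt u b a <= N - a.
Proof.
rewrite -sum_ord_ge [leqRHS](reindex_inj (@perm_inj _ u)) /=.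
by apply: leq_sum => q _; case: (q < b).
Qed.

Lemma cnt_val u b (a : 'I_N) : cnt u b a = cnt u b a.+1 + ((u^-1)%g a < b).
Proof.
have -> : ((u^-1)%g a < b : nat) = \sum_(q < N) ((q < b) && (u q == a)).
  rewrite (bigD1 ((u^-1)%g a)) //= permKV eqxx andbT big1 ?addn0 // => q qn.
  suff -> : (u q == a) = false by rewrite andbF.
  by apply: contraNF qn => /eqP <-; rewrite permK.
rewrite /cnt -big_split /=; apply: eq_bigr => q _.
by case: (q < b) => //=; rewrite leq_eqVlt -val_eqE eq_sym /=; lia.
Qed.

Lemma card_noninvs1 : #|noninvs (1%g : 'S_N)| = 'C(N, 2).
Proof.
rewrite -bin2_sum big_mkord -sum1_card.
transitivity (\sum_(p : 'I_N * 'I_N) (p.1 < p.2)).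
  by rewrite big_mkcond /=; apply: eq_bigr => p _; rewrite inE !perm1 andbb; case: ltnP.
rewrite -(pair_bigA _ (fun i j : 'I_N => (i < j) : nat)) exchange_big /=.
by apply: eq_bigr => j _; rewrite sum_ord_lt; have := ltn_ord j; lia.
Qed.

Lemma cntS u (b : 'I_N) a : cnt u b.+1 a = cnt u b a + (a <= u b).
Proof.
rewrite /cnt !(sum_split3 _ b) ltnn ltnS leqnn /= addn0 -!addnA.
rewrite [X in _ + (_ + X)]big1 ?addn0; last first.
  by move=> q bq; rewrite ltnS leqNgt bq.
rewrite [X in _ = _ + (X + _)]big1 ?add0n; last first.
  by move=> q bq; rewrite ltnNge (ltnW bq).
by congr (_ + _); apply: eq_bigr => q qb; rewrite ltnS (ltnW qb) qb.
Qed.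

End Noninversions.

(** * The strict rearrangement inequality *)

Section Rearrangement.
Variable k : nat.
Implicit Types (s : 'S_k) (i j : 'I_k).
Local Open Scope nat_scope.

(** An increasing [s] satisfies [s i >= i] everywhere, and both sides have the same sum. *)
Lemma perm_ascending s :
  (forall i j, j = i.+1 :> nat -> s i < s j) -> s = 1%g.
Proof.
move=> H; have ge a (ak : a < k) : a <= s (Ordinal ak).
  elim: a ak => // a IH ak; have ak' := ltnW ak.
  exact: leq_ltn_trans (IH ak') (H (Ordinal ak') (Ordinal ak) erefl).
have := leqif_sum (fun i (_ : xpredT i) => leqif_eq (ge i (ltn_ord i))).
case=> _; have -> : \sum_(i < k) s (Ordinal (ltn_ord i)) = \sum_(i < k) i.
  rewrite [RHS](reindex_inj (@perm_inj _ s)) /=; apply: eq_bigr => i _.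
  by congr (nat_of_ord (s _)); apply: val_inj.
rewrite eqxx => /esym/forall_inP h; apply/permP => i; rewrite perm1.
apply: val_inj; have /eqP := h i isT; rewrite /= => ->.
by congr (val (s _)); apply: val_inj.
Qed.

Lemma perm_descent s : s != 1%g -> exists i j, j = i.+1 :> nat /\ s j < s i.
Proof.
move=> s1; apply: contrapT => h; move/eqP: s1; apply; apply: perm_ascending => i j ij.
rewrite ltnNge; apply/negP; rewrite leq_eqVlt => /orP[/eqP/val_inj/perm_inj e|lt].
  by move: ij; rewrite e; lia.
by apply: h; exists i, j.
Qed.

Variables x y : 'I_k -> nat.
Hypothesis xinc : {homo x : i j / i < j}.
Hypothesis yinc : {homo y : i j / i < j}.

(** Undoing a descent at neighbouring positions strictly increases the sum, so every maximal
    permutation is the identity. *)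
Lemma rearrangement s : s != 1%g -> \sum_i x i * y (s i) < \sum_i x i * y i.
Proof.
pose W s := \sum_i x i * y (s i).
have step s' : s' != 1%g -> exists s'', W s' < W s''.
  move=> /perm_descent[i [j [ij sji]]]; exists (tperm i j * s')%g.
  have ilj : i < j by rewrite ij.
  have nij : j != i by rewrite -val_eqE /= ij; lia.
  rewrite /W (bigD1 i) //= [ltnRHS](bigD1 i) //= (bigD1 j) //= [in ltnRHS](bigD1 j) //=.
  rewrite !permM tpermL tpermR !addnA.
  have -> : \sum_(l < k | (l != i) && (l != j)) x l * y ((tperm i j * s')%g l) =
            \sum_(l < k | (l != i) && (l != j)) x l * y (s' l).
    by apply: eq_bigr => l /andP[li lj]; rewrite permM tpermD // eq_sym.
  rewrite ltn_add2r; have := xinc ilj; have := yinc sji; nia.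
have [smax _ Wmax] := @arg_maxnP _ 1%g xpredT W isT.
have W1 : smax = 1%g.
  apply/eqP; apply: contrapT => /negP /step [s'' lt].
  by have := Wmax s'' isT; rewrite /= leqNgt lt.
move=> /step[s'' lt]; have := leq_trans lt (Wmax s'' isT); rewrite W1.
by rewrite /W; under [X in _ < X]eq_bigr do rewrite perm1.
Qed.

End Rearrangement.

(** * Chains of boxes *)

Section Chains.
Variable n : nat.
Implicit Types (F : {set 'I_n * 'I_n}) (p q : 'I_n * 'I_n) (w : 'S_n).
Local Open Scope nat_scope.

Definition se p q := (p.1 < q.1) && (p.2 < q.2).

Definition chain F a i b r := exists s : seq ('I_n * 'I_n),
  [/\ size s = r, sorted se s
    & forall p, p \in s -> [&& p \in F, a <= p.1 < i & p.2 < b]].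

Lemma se_trans : transitive se.
Proof.
by move=> y x z /andP[h1 h2] /andP[h3 h4]; rewrite /se (ltn_trans h1 h3) (ltn_trans h2 h4).
Qed.

Lemma chain0 F a i b : chain F a i b 0.
Proof. by exists [::]. Qed.

Lemma chain_le F a a' i i' b b' r r' :
  a' <= a -> i <= i' -> b <= b' -> r' <= r -> chain F a i b r -> chain F a' i' b' r'.
Proof.
move=> aa ii bb rr [s [ss so sF]]; exists (take r' s); split.
- by rewrite size_take ss; case: ltngtP rr.
- exact: take_sorted.
- move=> p /mem_take /sF /and3P[-> /andP[h1 h2] h3] /=.
  by rewrite (leq_trans aa h1) (leq_trans h2 ii) (leq_trans h3 bb).
Qed.

Lemma chain_rcons F a (i k : 'I_n) r : (i, k) \in F -> a <= i ->
  chain F a i k r -> chain F a i.+1 k.+1 r.+1.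
Proof.
move=> Fik ai [s [ss so sF]]; exists (rcons s (i, k)); split.
- by rewrite size_rcons ss.
- case: s ss so sF => //= x s _ so sF; rewrite rcons_path so /=.
  by have /and3P[_ /andP[_ h] h'] := sF _ (mem_last x s); rewrite /se h h'.
- move=> p; rewrite mem_rcons inE => /orP[/eqP -> /=|/sF].
    by rewrite Fik ai !ltnS !leqnn.
  case/and3P=> -> /andP[-> h1] h2 /=.
  by rewrite !ltnS (ltnW h1) (ltnW h2).
Qed.

(* The cells of the rows above i and the first k cells of row i have been read.
   The frontier of this region is crossed by 2n strands, which u lists from the
   south-west to the north-east; they are labelled decreasingly at the start.
   A cell of F makes its two strands bounce; any other cell makes them cross,
   unless they crossed before. *)
Definition seaweed F i k (u : 'S_(n + n)) :=
  [/\ #|noninvs u| <=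
        #|[set p in ~: F | (p.1 < i) || (p.1 == i :> nat) && (p.2 < k)]|,
      forall a b, b <= k ->
        chain F a i.+1 b (cnt u (n.-1 - i + b) (n + a) - (n.-1 - i))
    & forall a b, k <= b <= n ->
        chain F a i b (cnt u (n - i + b) (n + a) - (n - i))].

Lemma seaweed_start F : exists u, seaweed F 0 0 u.
Proof.
exists (perm (@rev_ord_inj (n + n))); split.
- rewrite (_ : noninvs _ = finset.set0) ?cards0 //; apply/setP => -[x y].
  rewrite !inE /= !permE /=; case: (ltnP x y) => //= xy.
  by move: (ltn_ord x) (ltn_ord y); lia.
- move=> a b; rewrite leqn0 => /eqP ->; rewrite addn0.
  rewrite (_ : _ - _ = 0); first exact: chain0.
  by have := cnt_le_pos (perm (@rev_ord_inj (n + n))) (n.-1 - 0) (n + a); lia.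
- move=> a b _.
  rewrite (_ : _ - _ = 0); first exact: chain0.
  apply/eqP; rewrite subn_eq0 /cnt.
  apply: (@leq_trans (\sum_(q < n + n) (q < n))).
    apply: leq_sum => q _; rewrite permE /=.
    by move: (ltn_ord q); case: (ltnP q n); lia.
  by rewrite sum_ord_lt; lia.
Qed.

(** The frontier after row [i] is the frontier before row [i + 1]: the offset [n.-1 - i] of the rows
    just read equals [n - i.+1]. *)
Lemma seaweed_row F i u : seaweed F i n u -> seaweed F i.+1 0 u.
Proof.
move=> [h1 h2 h3]; split.
- apply: leq_trans h1 _; apply: subset_leq_card; apply/fintype.subsetP => p.
  rewrite !inE => /andP[-> /=]; rewrite ltnS.
  by case/orP => [/ltnW -> //|/andP[/eqP -> _]]; rewrite leqnn.
- move=> a b; rewrite leqn0 => /eqP ->; rewrite addn0.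
  rewrite (_ : _ - _ = 0); first exact: chain0.
  by have := cnt_le_pos u (n.-1 - i.+1) (n + a); lia.
- move=> a b /andP[_ bn]; have := h2 a b bn.
  by rewrite (_ : n.-1 - i = n - i.+1) //; lia.
Qed.

(** The two strands of the cell occupy the adjacent positions [q0] and [q1]. A crossing creates at
    most one non-inversion, paid for by a cell outside [F]. Only the count at [q1] can change; the
    chain it requires comes from the region to the west ([hA]), north ([hB]) or north-west
    ([hC]). *)
Lemma seaweed_cell F (i k : 'I_n) u :
  seaweed F i k u -> exists u', seaweed F i k.+1 u'.
Proof.
move=> [h1 h2 h3].
have q0P : n.-1 - i + k < n + n by move: (ltn_ord i) (ltn_ord k); lia.
have q1P : (n.-1 - i + k).+1 < n + n by move: (ltn_ord i) (ltn_ord k); lia.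
pose q0 := Ordinal q0P; pose q1 := Ordinal q1P.
have q01 : q0 < q1 by [].
pose u' := if ((i, k) \in F) || (u q0 < u q1) then u else (tperm q0 q1 * u)%g.
have cE b a : b != q1 :> nat -> cnt u' b a = cnt u b a.
  by move=> /= bq; rewrite /u'; case: ifP => // _; apply: cnt_tperm => //=; move: bq; lia.
have kin := ltn_ord k; have iin := ltn_ord i.
exists u'; split.
- have sub : #|[set p in ~: F | (p.1 < i) || (p.1 == i :> nat) && (p.2 < k)]| +
             ((i, k) \notin F) <=
     #|[set p in ~: F | (p.1 < i) || (p.1 == i :> nat) && (p.2 < k.+1)]|.
    rewrite [leqRHS](cardsD1 (i, k)) addnC; apply: leq_add.
      by rewrite !inE /= eqxx ltnS leqnn andbT orbT andbT.
    apply: subset_leq_card; apply/fintype.subsetP => -[x y]; rewrite !inE /= xpair_eqE.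
    case/andP=> -> /=; rewrite -!val_eqE /= => h.
    by apply/andP; split; move: h; lia.
  apply: leq_trans sub; rewrite /u'; case: ifPn.
    by move=> _; apply: leq_trans h1 (leq_addr _ _).
  rewrite negb_or => /andP[-> _]; rewrite addn1.
  exact: leq_trans (card_noninvs_adj _ _) _.
- move=> a b; rewrite leq_eqVlt => /orP[/eqP ->|bk]; last first.
    by rewrite cE; [apply: h2|rewrite /=; lia].
  have hA := h2 a k (leqnn _).
  have hB := h3 a k.+1; rewrite leqnSn kin in hB; have {}hB := hB erefl.
  have hC := h3 a k; rewrite leqnn (ltnW kin) in hC; have {}hC := hC erefl.
  rewrite addnS (cntS u' q0).
  have c1 : cnt u' (n.-1 - i + k) (n + a) = cnt u (n.-1 - i + k) (n + a).
    by apply: cE => /=; lia.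
  have c2 : cnt u' q1.+1 (n + a) = cnt u (n - i + k.+1) (n + a).
    by rewrite cE /=; [congr cnt|]; lia.
  rewrite (cntS u' q1) (cntS u' q0) /= c1 in c2.
  rewrite /= c1.
  case: (leqP (n + a) (u' q0)) => aq0; last first.
    by rewrite addn0; apply: chain_le hA.
  rewrite aq0 /= in c2.
  (* Outside [F] the strands leave in increasing order: if the one at [q0] is counted, so is the one
     at [q1], and the chain of [hB] is long enough. *)
  case Fik : ((i, k) \in F); last first.
    have u01 : u' q0 <= u' q1.
      rewrite /u' Fik /=; case: (ltnP (u q0) (u q1)) => [/ltnW //|].
      by rewrite !permM tpermL tpermR.
    rewrite (leq_trans aq0 u01) in c2.
    by apply: chain_le hB => //; rewrite -c2; lia.
  have u'E : u' = u by rewrite /u' Fik.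
  (* For [a > i] at most [n - a <= n.-1 - i] values are counted and the required length is 0;
     otherwise the cell extends the chain of [hC]. *)
  case: (leqP a i) => ai; last first.
    have := cnt_le_val u' q1 (n + a); rewrite (cntS u' q0) aq0 /= c1 => h.
    rewrite (_ : _ - _ = 0); first exact: chain0.
    by lia.
  apply: chain_le (chain_rcons Fik ai hC) => //.
  have -> : n - i + k = q0.+1 by rewrite /=; lia.
  by rewrite (cntS u q0) -u'E aq0 /= c1; lia.
- move=> a b /andP[kb bn]; rewrite cE; last by rewrite /=; lia.
  by apply: h3; rewrite (ltnW kb).
Qed.

Lemma seaweed_end F : exists u, seaweed F n 0 u.
Proof.
have H i : i <= n -> exists u, seaweed F i 0 u.
  elim: i => [_|i IH lin]; first exact: seaweed_start.
  have {IH} [u hu] := IH (ltnW lin).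
  suff H k : k <= n -> exists u', seaweed F i k u'.
    by have [u' /seaweed_row] := H n (leqnn n); exists u'.
  elim: k => [_|k IH lkn]; first by exists u.
  have [u' hu'] := IH (ltnW lkn).
  exact: (seaweed_cell (i := Ordinal lin) (k := Ordinal lkn) hu').
exact: H (leqnn n).
Qed.

(** The last n positions get the small values in decreasing order. Then every count outside the
    range [b <= n <= a] is the largest possible, min(b, 2n - a), and only the counts of [w] itself
    constrain a permutation below this one. *)
Definition extend_fun w (q : 'I_(n + n)) : 'I_(n + n) :=
  match split q with
  | inl j => rshift n (w j)
  | inr j => lshift n (rev_ord j)
  end.

Lemma extend_fun_inj w : injective (extend_fun w).
Proof.
move=> x y; rewrite -(splitK x) -(splitK y) /extend_fun.
case: (split x) => x'; case: (split y) => y'; rewrite !unsplitK => /(congr1 val) /=.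
- by move/addnI/val_inj/perm_inj ->.
- by have := ltn_ord y'; lia.
- by have := ltn_ord x'; lia.
- by move=> h; congr rshift; apply: val_inj => /=; have := ltn_ord x'; have := ltn_ord y'; lia.
Qed.

Definition extend w : 'S_(n + n) := perm (@extend_fun_inj w).

Lemma extend_lshift w j : extend w (lshift n j) = rshift n (w j).
Proof. by rewrite permE /extend_fun (unsplitK (inl j)). Qed.

Lemma extend_rshift w j : extend w (rshift n j) = lshift n (rev_ord j).
Proof. by rewrite permE /extend_fun (unsplitK (inr j)). Qed.

Lemma card_noninvs_extend w : #|noninvs w| <= #|noninvs (extend w)|.
Proof.
have finj : injective (fun p : 'I_n * 'I_n => (lshift n p.1, lshift n p.2)).
  by move=> [x y] [x' y'] [] h1 h2; congr (_, _); apply: val_inj.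
rewrite -(card_imset _ finj); apply: subset_leq_card; apply/fintype.subsetP => _ /imsetP[[x y] + ->].
by rewrite !inE /= !extend_lshift /= ltn_add2l.
Qed.

Lemma cnt_extend w b a : cnt (extend w) b a =
  \sum_(j < n) ((j < b) && (a <= n + w j)) + \sum_(j < n) ((n + j < b) && (a <= n - j.+1)).
Proof.
rewrite /cnt big_split_ord /=; congr (_ + _); apply: eq_bigr => j _.
  by rewrite extend_lshift.
by rewrite extend_rshift.
Qed.

(** Once all cells are read, the counts of the strand permutation are lengths of chains, so it lies
    below [extend w]. It then has at least as many non-inversions as [w], each paid for by a box
    outside [F]. *)
Lemma card_noninvs_chain F w :
  (forall a b r, b <= n -> chain F a n b r -> r <= cnt w b a) ->
  #|noninvs w| <= #|~: F|.
Proof.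
move=> H; have [u [h1 _ h3]] := seaweed_end F.
have {}h1 : #|noninvs u| <= #|~: F|.
  apply: leq_trans h1 _; apply: subset_leq_card.
  by apply/fintype.subsetP => p; rewrite !inE => /andP[].
apply: leq_trans h1; apply: leq_trans (card_noninvs_extend w) _.
apply: card_noninvs_bruhat => b a; rewrite cnt_extend.
have [bn|nb] := leqP b n.
  have [na|an] := leqP n a.
    apply: leq_trans (leq_addr _ _).
    have := H (a - n) b _ bn (h3 (a - n) b _).
    rewrite subnn add0n subn0 subnKC // => /(_ bn) /leq_trans; apply.
    by apply: leq_sum => j _; case: (j < b) => //=; lia.
  apply: leq_trans (cnt_le_pos _ _ _) _; apply: leq_trans (leq_addr _ _).
  have -> : minn (n + n) b = minn n b by lia.
  by rewrite -sum_ord_lt; apply: leq_sum => j _; case: (j < b) => //=; lia.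
have e1 : \sum_(j < n) ((j < b) && (a <= n + w j)) = n - (a - n).
  rewrite -sum_ord_ge [RHS](reindex_inj (@perm_inj _ w)) /=; apply: eq_bigr => j _.
  by have := ltn_ord j; lia.
have e2 : \sum_(j < n) ((n + j < b) && (a <= n - j.+1)) = minn (b - n) (n - a).
  transitivity (\sum_(j < n) (j < minn (b - n) (n - a))).
    by apply: eq_bigr => j _; have := ltn_ord j; lia.
  by rewrite sum_ord_lt; lia.
by rewrite e1 e2; have := cnt_le_pos u b a; have := cnt_le_val u b a; lia.
Qed.

End Chains.

(** * From the essential boxes to all south-west regions *)

Section EssentialChains.
Variables (n : nat) (w : 'S_n).
Implicit Types (F : {set 'I_n * 'I_n}) (p q : 'I_n * 'I_n).
Local Open Scope nat_scope.

Lemma card_dcirc : #|dcirc w| = #|noninvs w|.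
Proof.
pose f p : 'I_n * 'I_n := (p.2, (w^-1)%g p.1).
have finj : injective f.
  by move=> [x y] [x' y'] [/= -> /perm_inj ->].
rewrite -[RHS](card_preimset _ finj); apply: eq_card => -[x y].
by rewrite !inE /= permKV andbC.
Qed.

Lemma mem_ess p : p \in dcirc w ->
  (forall q, q \in dcirc w -> ~~ north_of q p && ~~ east_of q p) -> p \in ess w.
Proof.
move=> pD H; have eqR : {in dcirc w & &, equivalence_rel (connect (box_adj w))}.
  have sym : connect_sym (box_adj w).
    apply: sym_connect_sym => x y; rewrite /box_adj.
    by case: (x \in _); case: (y \in _); do 4?[case: (north_of _ _)|case: (east_of _ _)].
  move=> x y z _ _ _; split; first exact: connect0.
  by move=> xy; rewrite !(same_connect sym xy).
apply/bigcupP; exists (finset.pblock (dcirc_components w) p).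
  by apply: pblock_mem; rewrite (cover_partition (equivalence_partitionP eqR)).
rewrite inE mem_pblock (cover_partition (equivalence_partitionP eqR)) pD /=.
apply/forall_inP => q; rewrite /dcirc_components => qC; apply: H.
rewrite -(cover_partition (equivalence_partitionP eqR)).
by apply/bigcupP; exists (finset.pblock (dcirc_components w) p) => //; apply: pblock_mem;
  rewrite (cover_partition (equivalence_partitionP eqR)).
Qed.

(** Columns increase strictly along a chain, so at most its last box lies in column [b]. *)
Lemma chain_belast F a i b r : chain F a i b.+1 r.+1 -> chain F a i b r.
Proof.
move=> [s]; case/lastP: s => [|s x] [ss so sF] //.
move: ss so; rewrite size_rcons (sorted_pairwise (@se_trans n)) pairwise_rcons.
case=> ss /andP[/allP sx so]; exists s; split=> //.
  by rewrite (sorted_pairwise (@se_trans n)).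
move=> p ps; have psx : p \in rcons s x by rewrite mem_rcons inE ps orbT.
have /and3P[-> -> _] := sF p psx.
have /and3P[_ _ xb] : [&& x \in F, a <= x.1 < i & x.2 < b.+1].
  by apply: sF; rewrite mem_rcons mem_head.
by have /andP[_ px] := sx p ps; exact: leq_trans px xb.
Qed.

(** Likewise, at most the first box of a chain lies in row [a]. *)
Lemma chain_behead F a i b r : chain F a i b r.+1 -> chain F a.+1 i b r.
Proof.
move=> [[|x s] [ss so sF]] //; case: ss => ss.
move: so; rewrite (sorted_pairwise (@se_trans n)) /= => /andP[/allP xs so].
exists s; split=> //; first by rewrite (sorted_pairwise (@se_trans n)).
move=> p ps; have /and3P[-> /andP[_ ->] ->] := sF p (mem_behead (s := x :: s) ps).
have /and3P[_ /andP[ax _] _] := sF x (mem_head _ _).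
by have /andP[xp _] := xs p ps; rewrite (leq_ltn_trans ax xp).
Qed.

Definition chain_bounded F a b :=
  forall r, chain F a n b r -> r <= cnt w b a.

Lemma chain_bounded_dcirc F :
  (forall c, c \in ess w -> chain_bounded F c.1 c.2.+1) ->
  forall c, c \in dcirc w -> chain_bounded F c.1 c.2.+1.
Proof.
move=> H c; have [m] := ubnP (c.1 + (n - c.2)); elim: m c => // m IH [ci cj] /= cm cD.
have [/H //|] := boolP ((ci, cj) \in ess w).
have := mem_ess cD.
case: (pickP (fun q : 'I_n * 'I_n => (q \in dcirc w) && (north_of q (ci, cj) || east_of q (ci, cj)))); last first.
  move=> nq -> // q qD; have := nq q; rewrite qD /=.
  by case: north_of; case: east_of.
move=> [qi qj] /andP[qD qc] _ _ r hr; have := cD; rewrite inE => /= /andP[cD1 cD2].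
have := qD; rewrite inE => /= /andP[qD1 qD2].
have cn := ltn_ord cj.
rewrite /north_of /east_of /= in qc qD1 qD2.
case/orP: qc => [/andP[/eqP qc1 /eqP qc2]|/andP[/eqP qc1 /eqP qc2]].
  have bnd : chain_bounded F qi qj.+1 by apply: (IH (qi, qj)) => //=; rewrite qc2; lia.
  have := bnd r; rewrite cnt_val ltnS [(w^-1)%g qi <= qj]leqNgt qD2 addn0 qc1 qc2; apply.
  by apply: chain_le hr => //; rewrite -qc1.
have bnd : chain_bounded F qi qj.+1 by apply: (IH (qi, qj)) => //=; rewrite qc1; lia.
have := bnd r; rewrite cntS [qi <= w qj]leqNgt qD1 addn0 qc1 qc2; apply.
by apply: chain_le hr => //; rewrite qc1.
Qed.

(** At a corner outside the diagram, the 1 in the last column or in the top row lies in the region.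
    Deleting that line lowers the rank by one and shortens a chain by at most one box. *)
Lemma chain_bounded_all F :
  (forall c, c \in ess w -> chain_bounded F c.1 c.2.+1) ->
  forall a b, b <= n -> chain_bounded F a b.
Proof.
move=> /chain_bounded_dcirc H a b; have [m] := ubnP (n - a + b).
elim: m a b => // m IH a [|b] abm bn r.
  by case=> -[|x s] [<- _] // /(_ x (mem_head _ _)); rewrite !andbF.
case: (leqP n a) => [na|an].
  by case=> -[|x s] [<- _] // /(_ x (mem_head _ _)); have := ltn_ord x.1; lia.
pose c := (Ordinal an, Ordinal bn).
have [/H/(_ r) //|] := boolP (c \in dcirc w).
rewrite inE /= negb_and -!leqNgt => /orP[wb|wa] hr.
  rewrite (cntS w (Ordinal bn)) wb.
  case: r hr => // r /chain_belast /IH; rewrite addn1; apply; lia.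
rewrite (cnt_val w b.+1 (Ordinal an)) ltnS wa.
case: r hr => // r /chain_behead /IH; rewrite addn1; apply; lia.
Qed.

Definition avoids_ess F :=
  forall c, c \in ess w -> ~ chain F c.1 n c.2.+1 (cnt w c.2.+1 c.1).+1.

Lemma avoids_ess_card F : avoids_ess F -> #|dcirc w| <= #|~: F|.
Proof.
move=> H; rewrite card_dcirc; apply: card_noninvs_chain => a b r bn.
apply: chain_bounded_all bn r => c /H nc r hr; rewrite leqNgt; apply/negP => lt.
by apply: nc; apply: chain_le hr.
Qed.

Lemma se_path_size x s : path (@se n) x s ->
  (x.1 + size s <= (last x s).1) && (x.2 + size s <= (last x s).2).
Proof.
elim: s x => [|y s IH] x /=; first by rewrite !addn0 !leqnn.
by case/andP=> /andP[xy1 xy2] /IH /andP[h1 h2]; apply/andP; split; lia.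
Qed.

(** Among the first [b + 1] columns, at most [a] have their 1 above row [a]. *)
Lemma cnt_ge a (b : 'I_n) : b.+1 - a <= cnt w b.+1 a.
Proof.
have h : \sum_(q < n) (q < b.+1) <= cnt w b.+1 a + \sum_(q < n) (w q < a).
  rewrite -big_split; apply: leq_sum => q _ /=.
  by case: (q < b.+1); case: (leqP a (w q)).
move: h; have -> : \sum_(q < n) (w q < a) = \sum_(q < n) (q < a).
  by rewrite [RHS](reindex_inj (@perm_inj _ w)).
by rewrite !sum_ord_lt; have := ltn_ord b; lia.
Qed.

(** A chain through a strictly upper box [p] has at most [p.1 - c.1] boxes before [p] and
    [c.2 - p.2] after it, hence at most [c.2 - c.1] in all, too few by [cnt_ge]. All strictly upper
    boxes can therefore be added to [F] before counting. *)
Lemma avoids_ess_card_low F : (forall p, p \in F -> p.2 <= p.1) ->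
  avoids_ess F -> #|F| + #|dcirc w| + 'C(n, 2) <= n * n.
Proof.
move=> Flow H; pose U : {set 'I_n * 'I_n} := noninvs 1%g.
have UE p : (p \in U) = (p.1 < p.2) by rewrite inE !perm1 andbb.
have FU : [disjoint F & U].
  rewrite -setI_eq0; apply/eqP/setP => p; rewrite !inE !perm1 andbb.
  by apply/negP => /andP[/Flow]; rewrite leqNgt => /negP.
have : avoids_ess (F :|: U).
  move=> c cE [s [ss so sF]]; apply: (H c cE); exists s; split=> // p ps.
  have /and3P[pFU -> ->] := sF p ps; rewrite !andbT.
  move: pFU; rewrite inE => /orP[//|]; rewrite UE => pU.
  move: ss so sF; case/splitPr: ps => s1 s2 ss so sF.
  have aux (x y z : nat) : x + y <= z -> y <= z - x by lia.
  have h2 : size s2 <= c.2 - p.2.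
    have so2 : path (@se n) p s2.
      by case: s1 so {sF ss} => [|y s1] //=; rewrite cat_path /= => /and3P[].
    have /andP[_ le2] := se_path_size so2; apply: aux; apply: leq_trans le2 _.
    have : last p s2 \in s1 ++ p :: s2 by rewrite mem_cat mem_last orbT.
    by case/sF/and3P=> _ _; rewrite ltnS.
  have h1 : size s1 <= p.1 - c.1.
    case: s1 so sF {ss} => [|y s1] //=.
    rewrite -cat_rcons cat_path => /andP[/se_path_size /andP[+ _] _] sF.
    rewrite last_rcons size_rcons => le1; apply: aux; apply: leq_trans le1.
    by have /and3P[_ /andP[cy _] _] := sF y (mem_head _ _); rewrite leq_add2r.
  have := sF p; rewrite mem_cat mem_head orbT => /(_ erefl) /and3P[_ /andP[p1 _] p2].
  have aux2 (x y c1 c2 a b r : nat) : x < y -> c1 <= x -> y < c2.+1 -> a <= x - c1 ->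
    b <= c2 - y -> c2.+1 - c1 <= r -> a + b.+1 = r.+1 -> False by lia.
  rewrite size_cat /= in ss.
  by case: (aux2 _ _ _ _ _ _ _ pU p1 p2 h1 h2 (cnt_ge c.1 c.2) ss).
move/avoids_ess_card; have := cardsC (F :|: U); rewrite cardsU (_ : F :&: U = finset.set0).
  rewrite cards0 subn0 card_prod card_ord card_noninvs1; lia.
by apply/eqP; rewrite setI_eq0.
Qed.

End EssentialChains.

Local Open Scope classical_set_scope.
Local Open Scope ring_scope.

(** * Dimension of closed sets *)

Section Dimension.
Variables (F : fieldType) (m : nat).
Implicit Types (X Y Z S : set 'rV[F]_m) (p q : {mpoly F[m]}).

Lemma zclosedP X v : zclosed X -> ~ X v ->
  exists2 p, (forall x, X x -> p.@[x 0] = 0) & p.@[v 0] != 0.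
Proof.
move=> [S ->] nv; apply: contrapT => h; apply: nv => p Sp.
apply/eqP; apply: contrapT => /negP pv; apply: h; exists p => // x; exact.
Qed.

Lemma zclosed_locus p : zclosed [set v : 'rV[F]_m | p.@[v 0] = 0].
Proof.
exists [set p]; apply/seteqP; split => v /=; first by move=> pv _ ->.
by move=> /(_ p erefl).
Qed.

Lemma sub_zclosure S : S `<=` zclosure S.
Proof. by move=> v Sv Y _; apply. Qed.

Lemma zclosure_sub S Y : zclosed Y -> S `<=` Y -> zclosure S `<=` Y.
Proof. by move=> cY SY v; apply. Qed.

Lemma zclosed_zclosure S : zclosed (zclosure S).
Proof.
exists [set p | forall v, S v -> p.@[v 0] = 0]; apply/seteqP; split => v.
  move=> Sv p /= hp; have := Sv _ (zclosed_locus p); exact.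
move=> hv Y cY SY; apply: contrapT => /(zclosedP cY) [p pY /negP]; apply.
by apply/eqP; apply: hv => x /SY /pY.
Qed.

Lemma zirreducible_zclosure S : zirreducible S -> zirreducible (zclosure S).
Proof.
move=> [[v Sv] H]; split; first by exists v; apply: sub_zclosure.
move=> Y Z cY cZ h; have [|SY|SZ] := H Y Z cY cZ.
- by apply: subset_trans h; apply: sub_zclosure.
- by left; apply: zclosure_sub.
- by right; apply: zclosure_sub.
Qed.

Lemma zchain_zclosure X d (S : nat -> set 'rV[F]_m) :
  zclosed X -> S d `<=` X ->
  (forall k, (k <= d)%N -> zirreducible (S k)) ->
  (forall k, (k < d)%N -> S k `<=` S k.+1 /\ ~ S k.+1 `<=` zclosure (S k)) ->
  zchain X d (fun k => zclosure (S k)).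
Proof.
move=> cX SX irr inc; have sub k : (k <= d)%N -> S k `<=` X.
  elim: (d - k)%N {-2}k (erefl (d - k)%N) => [|e IH] {}k ek kd.
    by move: ek => /eqP; rewrite subn_eq0 => dk; rewrite (_ : k = d) //; apply/eqP; rewrite eqn_leq kd.
  have kd' : (k < d)%N by rewrite -subn_gt0 ek.
  have [h _] := inc k kd'; apply: subset_trans h _; apply: IH => //.
  by rewrite subnS ek.
split=> [k kd|k kd]; last first.
  have [h1 h2] := inc k kd; split.
    by apply: zclosure_sub; [exact: zclosed_zclosure|apply: subset_trans h1 _; exact: sub_zclosure].
  by move=> h; apply: h2; apply: subset_trans h; apply: sub_zclosure.
split; first exact: zclosed_zclosure.
  exact: zirreducible_zclosure (irr k kd).
exact: zclosure_sub (sub k kd).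
Qed.

(** Any [d + 1] polynomial functions on [X] are algebraically dependent; the bound [N] on the
    exponents makes the relation a finite sum. *)
Definition trdeg_le X d := forall g : 'I_d.+1 -> {mpoly F[m]},
  exists N (c : {ffun 'I_d.+1 -> 'I_N.+1} -> F), (exists e, c e != 0) /\
    forall v, X v -> \sum_e c e * \prod_i (g i).@[v 0] ^+ e i = 0.

Lemma trdeg_le_sub X Y d : X `<=` Y -> trdeg_le Y d -> trdeg_le X d.
Proof.
move=> XY H g; have [N [c [c0 hc]]] := H g.
by exists N, c; split=> // v /XY /hc.
Qed.

(* Choose f_k vanishing on T_k but not on T_(k+1). In a relation among f_0, ...,
   f_d on T_(d+1), divide by the least power of f_d, which irreducibility allows,
   and restrict to T_d: a shorter relation among f_0, ..., f_(d-1) remains. *)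
Lemma zchain_le X d e T : trdeg_le X d -> zchain X e T -> (e <= d)%N.
Proof.
move=> dep [cT iT]; rewrite leqNgt; apply/negP => de.
have sT k : (k <= d)%N -> T k `<=` T k.+1.
  by move=> kd; have [] := iT k (leq_ltn_trans kd de).
have Hf (k : 'I_d.+1) : exists f : {mpoly F[m]},
    (forall v, T k v -> f.@[v 0] = 0) /\ exists2 v, T k.+1 v & f.@[v 0] != 0.
  have kd : (k < e)%N := leq_trans (ltn_ord k) de.
  have [cTk _ _] := cT k (ltnW kd).
  have [_ /existsNP[v /not_implyP[Tv nTv]]] := iT k kd.
  by have [p hp pv] := zclosedP cTk nTv; exists p; split=> //; exists v.
have [f {}Hf] := choice Hf; have [N [c [[e0 ce0] Hc]]] := dep f.
pose term (k : nat) (a : {ffun 'I_d.+1 -> 'I_N.+1}) (v : 'rV[F]_m) :=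
  c a * \prod_(i : 'I_d.+1 | (i < k)%N) (f i).@[v 0] ^+ a i.
(* Descending induction on [k]: the exponents in [A] agree from index [k] on, so this is a relation
   among the first [k] functions. At [k = 0] a single nonzero coefficient would have to vanish on
   [T 0]. *)
suff key k : (k <= d.+1)%N -> forall A : {set {ffun 'I_d.+1 -> 'I_N.+1}},
    A != finset.set0 -> (forall a, a \in A -> c a != 0) ->
    (forall a b, a \in A -> b \in A -> forall i : 'I_d.+1, (k <= i)%N -> a i = b i) ->
    (forall v, T k v -> \sum_(a in A) term k a v = 0) -> False.
  apply: (key d.+1 (leqnn _) [set a | c a != 0]%SET).
  - by apply/set0Pn; exists e0; rewrite inE.
  - by move=> a; rewrite inE.
  - by move=> a b _ _ i; rewrite leqNgt ltn_ord.
  - move=> v Tv; have [_ _ TX] := cT d.+1 de; rewrite -[RHS](Hc v (TX v Tv)).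
    rewrite [RHS](bigID (fun a => c a != 0)) /= [X in _ = _ + X]big1 ?addr0; last first.
      by move=> a /negbNE/eqP ->; rewrite mul0r.
    apply: eq_big => [a|a _]; first by rewrite inE.
    by congr (_ * _); apply: eq_bigl => i; rewrite ltn_ord.
elim: k => [_|k IH kd] A /set0Pn[a0 Aa0] cA agree vanish.
  have A1 : A = [set a0]%SET.
    apply/setP => a; rewrite inE; apply/idP/eqP => [Aa|-> //].
    by apply/ffunP => i; apply: agree.
  have [_ [[v Tv] _] _] := cT 0%N isT.
  have := vanish v Tv; rewrite A1 big_set1 /term big_pred0_eq mulr1 => /eqP.
  exact/negP/cA.
pose kk : 'I_d.+1 := Ordinal kd.
have [a1 Aa1 amin] := @arg_minnP _ a0 (fun a => a \in A) (fun a => val (a kk)) Aa0.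
pose r := val (a1 kk).
pose Q : {mpoly F[m]} := \sum_(a in A)
  c a *: (f kk ^+ (a kk - r) * \prod_(i : 'I_d.+1 | (i < k)%N) (f i) ^+ a i).
have QE (v : 'rV[F]_m) : Q.@[v 0] = \sum_(a in A)
    (f kk).@[v 0] ^+ (a kk - r) * term k a v.
  rewrite /Q raddf_sum; apply: eq_bigr => a _ /=.
  rewrite mevalZ mevalM rmorphXn rmorph_prod mulrCA; congr (_ * (_ * _)).
  by apply: eq_bigr => i _; rewrite rmorphXn.
have TQ : T k.+1 `<=` [set v | (f kk).@[v 0] = 0] `|` [set v | Q.@[v 0] = 0].
  move=> v Tv; have := vanish v Tv.
  have -> : \sum_(a in A) term k.+1 a v = (f kk).@[v 0] ^+ r * Q.@[v 0].
    rewrite QE big_distrr /=; apply: eq_bigr => a Aa.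
    rewrite mulrA -exprD subnKC; last exact: amin.
    rewrite /term (bigD1 kk) ?ltnS //= mulrCA; congr (_ * (_ * _)).
    apply: eq_bigl => i; rewrite ltnS -val_eqE /= [in RHS]ltn_neqAle andbC.
    by [].
  move/eqP; rewrite mulf_eq0 => /orP[|/eqP]; last by right.
  by rewrite expf_eq0 => /andP[_ /eqP]; left.
have [_ [_ irr] _] := cT k.+1 (leq_trans kd de).
have [|] := irr _ _ (zclosed_locus (f kk)) (zclosed_locus Q) TQ.
  have [_ [v Tv fv]] := Hf kk => /(_ v Tv) /= fv0.
  by rewrite fv0 eqxx in fv.
move=> TQ0; apply: (IH (ltnW kd) [set a in A | a kk == a1 kk]%SET).
- by apply/set0Pn; exists a1; rewrite inE Aa1 eqxx.
- by move=> a; rewrite inE => /andP[/cA].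
- move=> a b; rewrite !inE => /andP[Aa /eqP ak] /andP[Ab /eqP bk] i.
  rewrite leq_eqVlt => /orP[/eqP ki|]; last exact: agree.
  by rewrite (_ : i = kk) ?ak ?bk //; apply: val_inj.
- move=> v Tv; have := TQ0 v (sT k _ v Tv); rewrite -ltnS => /(_ kd) /= Qv.
  rewrite -[RHS]Qv QE [RHS](bigID (fun a : {ffun 'I_d.+1 -> 'I_N.+1} => a kk == a1 kk)) /=.
  rewrite [X in _ = _ + X]big1 ?addr0; last first.
    move=> a /andP[Aa ak]; have [-> // _] := Hf kk.
    rewrite expr0n subn_eq0 -/r; case: leqP => [ar|_]; last by rewrite mul0r.
    by move: ak; rewrite -val_eqE eqn_leq ar amin.
  apply: eq_big => [a|a]; first by rewrite inE.
  by rewrite inE => /andP[_ /eqP ->]; rewrite /r subnn expr0 mul1r.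
Qed.

End Dimension.

(** * Polynomial functions on affine space *)

Section PolynomialFunctions.
Variables (F : fieldType) (d : nat).
Implicit Types (f g : 'rV[F]_d -> F).

Definition polyfun f := exists p : {mpoly F[d]}, forall x, f x = p.@[x 0].

Lemma polyfun_cst c : polyfun (fun=> c).
Proof. by exists c%:MP => x; rewrite mevalC. Qed.

Lemma polyfun_coord i : polyfun (fun x => x 0 i).
Proof. by exists 'X_i => x; rewrite mevalXU. Qed.

Lemma polyfunD f g : polyfun f -> polyfun g -> polyfun (fun x => f x + g x).
Proof. by move=> [p fp] [q gq]; exists (p + q) => x; rewrite mevalD fp gq. Qed.

Lemma polyfunM f g : polyfun f -> polyfun g -> polyfun (fun x => f x * g x).
Proof. by move=> [p fp] [q gq]; exists (p * q) => x; rewrite mevalM fp gq. Qed.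

Lemma polyfun_sum (I : finType) (f : I -> 'rV[F]_d -> F) :
  (forall i, polyfun (f i)) -> polyfun (fun x => \sum_i f i x).
Proof.
move=> /choice [p fp]; exists (\sum_i p i) => x.
by rewrite raddf_sum; apply: eq_bigr.
Qed.

Lemma polyfun_prod (I : finType) (P : pred I) (f : I -> 'rV[F]_d -> F) :
  (forall i, polyfun (f i)) -> polyfun (fun x => \prod_(i | P i) f i x).
Proof.
move=> /choice [p fp]; exists (\prod_(i | P i) p i) => x.
by rewrite rmorph_prod; apply: eq_bigr.
Qed.

Lemma polyfun_comp m (psi : 'rV[F]_d -> 'rV[F]_m) (q : {mpoly F[m]}) :
  (forall j, polyfun (fun x => psi x 0 j)) -> polyfun (fun x => q.@[(psi x) 0]).
Proof.
move=> /choice [p psip]; exists (q \mPo [tuple p j | j < m]) => x.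
by rewrite comp_mpoly_meval; apply: meval_eq => j; rewrite tnth_mktuple.
Qed.

End PolynomialFunctions.

(** * Irreducibility of polynomial images of coordinate subspaces *)

Section Irreducible.
Variables (F : numFieldType) (d : nat).
Implicit Types (S : set 'rV[F]_d) (p q : {mpoly F[d]}).

Definition meets S p := exists2 x, S x & p.@[x 0] != 0.

(** Irreducibility in the parameter space: the polynomials vanishing on [S] form a prime ideal. *)
Definition prime_set S := S !=set0 /\
  forall p q, meets S p -> meets S q -> meets S (p * q).

(** In characteristic zero the numerals are distinct, and there are more of them than P can have
    roots. *)
Lemma poly_nonroot (P : {poly F}) : P != 0 -> exists t, P.[t] != 0.
Proof.
move=> P0; apply: contrapT => h.
have := @max_poly_roots _ P [seq i%:R | i <- iota 0 (size P)] P0.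
rewrite size_map size_iota ltnn map_inj_uniq ?iota_uniq; last first.
  by move=> i j /eqP; rewrite eqr_nat => /eqP.
suff rP : all (root P) [seq i%:R | i <- iota 0 (size P)] by move/(_ rP isT).
apply/allP => t _; apply/eqP; apply: contrapT => /eqP Pt.
by apply: h; exists t.
Qed.

Lemma meval_line p x (u : 'rV[F]_d) :
  exists P : {poly F}, forall t, P.[t] = p.@[(x + t *: u) 0].
Proof.
exists (mmap (@polyC F) (fun i => (x 0 i)%:P + (u 0 i) *: 'X) p) => t.
rewrite /meval /mmap horner_sum; apply: eq_bigr => e _.
rewrite hornerM hornerC; congr (_ * _).
rewrite /mmap1 horner_prod; apply: eq_bigr => i _.
by rewrite horner_exp !hornerE !mxE mulrC.
Qed.

Lemma meval_translate p (u : 'rV[F]_d) :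
  exists q, forall x : 'rV[F]_d, q.@[x 0] = p.@[(x + u) 0].
Proof.
have [i|q hq] := @polyfun_comp F d d (fun x => x + u) p.
  have [q hq] := polyfunD (polyfun_coord F i) (polyfun_cst d (u 0 i)).
  by exists q => x; rewrite mxE hq.
by exists q => x; rewrite hq.
Qed.

(** Each polynomial is nonzero on some line in direction [u], so one parameter [t] is good for both;
    translating by [t *: u] reduces the claim to [S]. *)
Lemma prime_set_line S (u : 'rV[F]_d) :
  prime_set S -> prime_set [set y | exists x t, S x /\ y = x + t *: u].
Proof.
move=> [[x0 Sx0] H]; split; first by exists x0, x0, 0; rewrite scale0r addr0.
move=> p q [_ [xp [tp [Sxp ->]]] pn0] [_ [xq [tq [Sxq ->]]] qn0].
have [P hP] := meval_line p xp u; have [Q hQ] := meval_line q xq u.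
have PQ0 : P * Q != 0.
  rewrite mulf_neq0 //; apply/eqP => e0.
    by move: pn0; rewrite -hP e0 horner0 eqxx.
  by move: qn0; rewrite -hQ e0 horner0 eqxx.
have [t] := poly_nonroot PQ0; rewrite hornerM mulf_eq0 negb_or hP hQ => /andP[pt qt].
have [p' hp'] := meval_translate p (t *: u); have [q' hq'] := meval_translate q (t *: u).
have [||x Sx] := H p' q'; [by exists xp; rewrite ?hp'|by exists xq; rewrite ?hq'|].
rewrite mevalM hp' hq' => pqx; exists (x + t *: u); first by exists x, t.
by rewrite mevalM.
Qed.

Definition coord_subspace k : set 'rV[F]_d := [set x | forall i : 'I_d, (k <= i)%N -> x 0 i = 0].

(** Starting from the origin, the subspace is swept along one further coordinate axis at a time. *)
Lemma prime_coord_subspace k : (k <= d)%N -> prime_set (coord_subspace k).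
Proof.
elim: k => [_|k IH kd].
  have E x : coord_subspace 0 x -> x = 0.
    by move=> h; apply/rowP => i; rewrite mxE h.
  split; first by exists 0 => i _; rewrite mxE.
  move=> p q [x /E -> p0] [y /E -> q0]; exists 0; first by move=> i _; rewrite mxE.
  by rewrite mevalM mulf_neq0.
have := prime_set_line (delta_mx 0 (Ordinal kd)) (IH (ltnW kd)).
congr prime_set; apply/seteqP; split=> y.
  move=> [x [t [hx ->]]] i ki; rewrite !mxE hx ?(ltnW ki) // add0r.
  by rewrite [i == _](_ : _ = false) ?andbF ?mulr0 //; apply/negbTE; rewrite -val_eqE /= gtn_eqF.
move=> hy; exists (y - y 0 (Ordinal kd) *: delta_mx 0 (Ordinal kd)), (y 0 (Ordinal kd)).
rewrite subrK; split=> // i; rewrite leq_eqVlt => /orP[/eqP ki|ki].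
  by rewrite (_ : i = Ordinal kd) ?mxE ?eqxx ?mulr1 ?subrr //; apply: val_inj.
rewrite !mxE (hy i) // [i == _](_ : _ = false) ?andbF ?mulr0 ?subrr //.
by apply/negbTE; rewrite -val_eqE /= gtn_eqF.
Qed.

Section Image.
Variables (m : nat) (psi : 'rV[F]_d -> 'rV[F]_m).
Hypothesis psiP : forall j, polyfun (fun x => psi x 0 j).

Lemma zirreducible_image S : prime_set S -> zirreducible (psi @` S).
Proof.
move=> [[x0 Sx0] H]; split; first by exists (psi x0), x0.
move=> Y Z cY cZ YZ; apply: contrapT => /not_orP[nY nZ].
have sep W : zclosed W -> ~ psi @` S `<=` W ->
    exists2 p, meets S p & forall x, W (psi x) -> p.@[x 0] = 0.
  move=> cW /existsNP[_ /not_implyP[[x Sx <-] nWx]].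
  have [p Wp px] := zclosedP cW nWx.
  have [q hq] := polyfun_comp p psiP.
  by exists q; [exists x; rewrite // -hq|move=> y Wy; rewrite -hq; apply: Wp].
have [p mp Yp] := sep Y cY nY; have [q mq Zq] := sep Z cZ nZ.
have [x Sx] := H p q mp mq; rewrite mevalM mulf_eq0 negb_or => /andP[/eqP px /eqP qx].
by have [|/Yp|/Zq] := YZ (psi x) ; [exists x|exact: px|exact: qx].
Qed.

(** The open subset [f != 0] is dense in [S]: a polynomial separating a point of the image from [Y],
    pulled back and multiplied by [f], is nonzero somewhere on [S]. *)
Lemma closed_image_dense S f Y : prime_set S -> polyfun f ->
  (exists2 x, S x & f x != 0) -> zclosed Y ->
  (forall x, S x -> f x != 0 -> Y (psi x)) -> psi @` S `<=` Y.
Proof.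
move=> [_ H] [p hp] [x0 Sx0 fx0] cY hY _ [x Sx <-]; apply: contrapT => nY.
have [q Yq qx] := zclosedP cY nY; have [q' hq'] := polyfun_comp q psiP.
have [||y Sy] := H p q'; first by exists x0; rewrite -?hp.
  by exists x; rewrite -?hq'.
rewrite mevalM mulf_eq0 negb_or -hp -hq' => /andP[fy /eqP].
by apply; apply: Yq; apply: hY.
Qed.

End Image.

End Irreducible.

(** * Upper bound on the dimension *)

Lemma linear_relation (F : fieldType) (I J : finType) (B : {set J}) (A : I -> J -> F) :
  (#|B| < #|I|)%N ->
  exists c : I -> F, (exists i, c i != 0) /\
    forall j, j \in B -> \sum_i c i * A i j = 0.
Proof.
move=> BI; pose M : 'M[F]_(#|I|, #|B|) := \matrix_(i, j) A (enum_val i) (enum_val j).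
have : kermx M != 0.
  rewrite kermx_eq0 /row_free neq_ltn; apply/orP; left.
  exact: leq_ltn_trans (rank_leq_col M) BI.
case/rowV0Pn => v /sub_kermxP vM v0; exists (fun i => v 0 (enum_rank i)); split.
  apply: contrapT => h; move/eqP: v0; apply; apply/rowP => i; rewrite mxE.
  by apply/eqP; apply: contrapT => /negP vi; apply: h; exists (enum_val i); rewrite enum_valK.
move=> j jB; have := congr1 (fun u : 'rV_#|B| => u 0 (enum_rank_in jB j)) vM.
rewrite !mxE => vMj; rewrite -[RHS]vMj (reindex (@enum_val I predT)) /=.
  by apply: eq_bigr => i _; rewrite mxE enum_valK enum_rankK_in.
by exists enum_rank => i _; rewrite ?enum_valK ?enum_rankK.
Qed.

Lemma enum_val_homo n (A : pred 'I_n) : {homo @enum_val _ A : i j / (i < j)%N}.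
Proof.
move=> i j ij; have [x0 _] : exists x : 'I_n, True by exists (enum_val i).
rewrite (enum_val_nth x0 i) (enum_val_nth x0 j).
have so : sorted ltn (map val (enum A)).
  have := iota_ltn_sorted 0 n; rewrite -val_enum_ord.
  apply: subseq_sorted; first exact: ltn_trans.
  by apply: map_subseq; rewrite enumT; apply: filter_subseq.
have := sorted_ltn_nth ltn_trans 0 so.
move=> /(_ i j); rewrite !inE !size_map -!cardE => /(_ (ltn_ord i) (ltn_ord j) ij).
by rewrite !(nth_map x0) // -cardE.
Qed.

Lemma enum_rank_in_homo n (A : pred 'I_n) x0 (Ax0 : x0 \in A) :
  {in A &, {homo enum_rank_in Ax0 : i j / (i < j)%N}}.
Proof.
move=> i j iA jA ij; rewrite ltnNge leq_eqVlt; apply/negP => /orP[/eqP/val_inj e|].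
  by move: ij; rewrite -(enum_rankK_in Ax0 iA) -e enum_rankK_in ?ltnn.
by move/enum_val_homo; rewrite !enum_rankK_in // ltnNge (ltnW ij).
Qed.

(** Rows and columns increase strictly along a chain, so they select a minor; its main diagonal, the
    term of the identity permutation, consists of the boxes of the chain. *)
Lemma diagonal_minor (R : comNzRingType) n (a b : 'I_n) (G : 'M[R]_n)
    (s : seq ('I_n * 'I_n)) :
  sorted (@se n) s -> (forall p, p \in s -> (a <= p.1)%N && (p.2 <= b)%N) ->
  minors (size s) (swsub a b G)
    (\sum_(t : 'S_(size s)) (-1) ^+ t *
       \prod_i G (tnth (in_tuple s) i).1 (tnth (in_tuple s) (t i)).2).
Proof.
case: s => [|p0 s] so sab.
  have f0 (T : Type) : 'I_0 -> T by case.
  exists (f0 _), (f0 _).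
  split; [by case|by case|].
  rewrite /determinant; apply: eq_bigr => t _; congr (_ * _).
  by rewrite !big_ord0.
set ss := p0 :: s in so sab *.
have tab i : (tnth (in_tuple ss) i \in ss) by apply: mem_tnth.
have [h1 h2] := andP (sab p0 (mem_head _ _)).
pose rk1 := @enum_rank_in _ p0.1 [pred i : 'I_n | (a <= i)%N] h1.
pose rk2 := @enum_rank_in _ p0.2 [pred i : 'I_n | (i <= b)%N] h2.
have inc (i j : 'I_(size ss)) : (i < j)%N -> se (tnth (in_tuple ss) i) (tnth (in_tuple ss) j).
  move=> ij; have := sorted_ltn_nth (@se_trans n) p0 so.
  move=> /(_ i j); rewrite !inE => /(_ (ltn_ord i) (ltn_ord j) ij).
  by rewrite -!(tnth_nth _ (in_tuple ss)).
have in1 i : (tnth (in_tuple ss) i).1 \in [pred i : 'I_n | (a <= i)%N].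
  by have /andP[] := sab _ (tab i).
have in2 i : (tnth (in_tuple ss) i).2 \in [pred i : 'I_n | (i <= b)%N].
  by have /andP[] := sab _ (tab i).
exists (fun i => rk1 (tnth (in_tuple ss) i).1), (fun i => rk2 (tnth (in_tuple ss) i).2); split.
- by move=> i j /inc/andP[? _]; apply: enum_rank_in_homo.
- by move=> i j /inc/andP[_ ?]; apply: enum_rank_in_homo.
- rewrite /determinant; apply: eq_bigr => t _; congr (_ * _); apply: eq_bigr => i _.
  by rewrite !mxE /rk1 /rk2 !enum_rankK_in.
Qed.

Section UpperBound.
Variables (F : fieldType) (n m : nat) (w : 'S_n) (G : 'M[{mpoly F[m]}]_n).
Variables (pos : 'I_m -> 'I_n * 'I_n) (d : nat).
Hypothesis Gpos : forall v, G (pos v).1 (pos v).2 = 'X_v.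
(** Only the product of row and column is prescribed: a variable of the generic symmetric matrix
    occupies two transposed boxes, and the weight i j is the same at both. *)
Hypothesis Gother : forall i j, G i j = 0 \/
  exists2 v, G i j = 'X_v & ((pos v).1 * (pos v).2 = i * j)%N.
Hypothesis avoids_le : forall V : {set 'I_m}, avoids_ess w (pos @: V)%SET -> (#|V| <= d)%N.
Hypothesis rank_cnt : forall a b, swrank (wmx F w) a b = cnt w b.+1 a.

Let X := fulton_variety w G.
Let wt (e : 'X_{1..m}) := (\sum_v e v * ((pos v).1 * (pos v).2))%N.

Let wtD e e' : wt (e + e')%MM = (wt e + wt e')%N.
Proof. by rewrite -big_split; apply: eq_bigr => v _; rewrite mnmDE mulnDl. Qed.

Let wtU v : wt U_(v)%MM = ((pos v).1 * (pos v).2)%N.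
Proof.
rewrite /wt (bigD1 v) //= mnm1E eqxx mul1n big1 ?addn0 // => u uv.
by rewrite mnm1E eq_sym (negbTE uv).
Qed.

Let wt_sum k (f : 'I_k -> 'X_{1..m}) : wt (\sum_i f i)%MM = (\sum_i wt (f i))%N.
Proof.
elim/big_rec2: _ => [|i y1 y2 _ <-]; last exact: wtD.
by rewrite /wt big1 // => v _; rewrite mnm0E.
Qed.

Let mpolyX_sum k (f : 'I_k -> 'X_{1..m}) :
  'X_[(\sum_i f i)%MM] = \prod_i 'X_[f i] :> {mpoly F[m]}.
Proof. exact: (big_morph _ (@mpolyXD _ _) (@mpolyX0 _ _)). Qed.

Let msupport (e : 'X_{1..m}) : {set 'I_m} := [set v | e v != 0%N]%SET.
Let standard (e : 'X_{1..m}) := avoids_ess w (pos @: msupport e)%SET.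

Lemma straighten_term k (x y : 'I_k -> 'I_n) :
  (forall v : 'rV[F]_m, (\prod_i G (x i) (y i)).@[v 0] = 0) \/
  exists e, [/\ mdeg e = k, wt e = (\sum_i x i * y i)%N
     & \prod_i G (x i) (y i) = 'X_[e]].
Proof.
have [[i Gi]|/forallNP nG] := pselect (exists i, G (x i) (y i) = 0).
  by left=> v; rewrite (bigD1 i) //= Gi mul0r meval0.
have /choice[u hu] i : exists v, G (x i) (y i) = 'X_v /\ ((pos v).1 * (pos v).2 = x i * y i)%N.
  by have [/nG//|[v]] := Gother (x i) (y i); exists v.
right; exists (\sum_i U_(u i))%MM; split.
- by rewrite mdeg_sum; under eq_bigr do rewrite mdeg1; rewrite sum1_card card_ord.
- by rewrite wt_sum; apply: eq_bigr => i _; rewrite wtU; case: (hu i).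
- by rewrite mpolyX_sum; apply: eq_bigr => i _; case: (hu i).
Qed.

(** Congruence modulo the ideal is expressed as equality of functions on [X]; bounding each exponent
    by [D] makes the span finite-dimensional. *)
Definition std_span D (h : 'rV[F]_m -> F) :=
  exists c : {ffun 'I_m -> 'I_D.+1} -> F, forall v, X v ->
    h v = \sum_(e : {ffun 'I_m -> 'I_D.+1} | `[< standard [multinom val (e i) | i < m] >])
             c e * \prod_i v 0 i ^+ e i.

Lemma std_span0 D h : (forall v, X v -> h v = 0) -> std_span D h.
Proof.
by move=> h0; exists (fun=> 0) => v /h0 ->; rewrite big1 // => e _; rewrite mul0r.
Qed.

Lemma std_spanDZ D a h h' : std_span D h -> std_span D h' ->
  std_span D (fun v => a * h v + h' v).
Proof.
move=> [c hc] [c' hc']; exists (fun e => a * c e + c' e) => v Xv.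
rewrite hc // hc' // big_distrr -big_split /=; apply: eq_bigr => e _.
by rewrite mulrDl mulrA.
Qed.

Lemma std_span_sum D (I : eqType) (r : seq I) (a : I -> F) (h : I -> 'rV[F]_m -> F) :
  (forall i, i \in r -> std_span D (h i)) ->
  std_span D (fun v => \sum_(i <- r) a i * h i v).
Proof.
elim: r => [|i r IH] H; first by apply: std_span0 => v _; rewrite big_nil.
have [|c hc] := std_spanDZ (a i) (H i (mem_head _ _)) (IH _).
  by move=> j jr; apply: H; rewrite inE jr orbT.
by exists c => v Xv; rewrite big_cons hc.
Qed.

Lemma std_span_eq D h h' : (forall v, X v -> h v = h' v) -> std_span D h -> std_span D h'.
Proof. by move=> hh [c hc]; exists c => v Xv; rewrite -hh // hc. Qed.

Lemma vanishing_diagonal e : ~ standard e ->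
  exists k (p : k.-tuple ('I_n * 'I_n)) (u : 'I_k -> 'I_m),
   [/\ forall i j : 'I_k, (i < j)%N -> se (tnth p i) (tnth p j),
       forall i, pos (u i) = tnth p i, forall i, e (u i) != 0%N
     & forall v, X v -> (\sum_(t : 'S_k) (-1) ^+ t *
         \prod_i G (tnth p i).1 (tnth p (t i)).2).@[v 0] = 0].
Proof.
move=> /existsNP[c /not_implyP[cE /contrapT[s [ss so sF]]]].
exists (size s), (in_tuple s).
have /choice[u hu] (i : 'I_(size s)) : exists v, pos v = tnth (in_tuple s) i /\ e v != 0%N.
  have /and3P[/imsetP[v] + ->] := sF _ (mem_tnth i (in_tuple s)).
  by rewrite inE => ev; exists v.
exists u; split=> [i j ij|i|i|v Xv]; try by case: (hu i).
  have [x0 _] : exists x : 'I_n * 'I_n, True by exists (tnth (in_tuple s) i).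
  have := sorted_ltn_nth (@se_trans n) x0 so.
  move=> /(_ i j); rewrite !inE => /(_ (ltn_ord i) (ltn_ord j) ij).
  by rewrite -!(tnth_nth _ (in_tuple s)).
apply: Xv; exists [:: (1, \sum_(t : 'S_(size s)) (-1) ^+ t *
   \prod_i G (tnth (in_tuple s) i).1 (tnth (in_tuple s) (t i)).2)]; last first.
  by rewrite big_seq1 mul1r.
move=> q; rewrite inE => /eqP -> /=; exists c => //.
rewrite rank_cnt -ss; apply: diagonal_minor => // p /sF /and3P[_ /andP[-> _]].
by rewrite ltnS.
Qed.

(* Give the variable at (i, j) the weight i * j: by the rearrangement inequality,
   the term of a minor along its main diagonal is the only one of highest
   weight, so that a non-standard monomial is, modulo the minors, a combination
   of monomials of smaller weight. *)
Lemma std_span_monomial D e : (mdeg e <= D)%N -> std_span D (fun v => 'X_[e].@[v 0]).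
Proof.
have [N] := ubnP (wt e); elim: N e => // N IH e eN eD.
have [std|nstd] := pselect (standard e).
  have le i : (e i < D.+1)%N.
    rewrite ltnS; apply: leq_trans eD; rewrite mdegE (bigD1 i) //=; exact: leq_addr.
  exists (fun e' => (e' == [ffun i => Ordinal (le i)])%:R) => v _.
  have E : [multinom val ([ffun i => Ordinal (le i)] i) | i < m] = e.
    by apply/mnmP => i; rewrite mnmE ffunE.
  rewrite (bigD1 [ffun i => Ordinal (le i)]) /=; last by apply/asboolP; rewrite E.
  rewrite eqxx mul1r [X in _ + X]big1 ?addr0; last by move=> e' /andP[_ /negbTE ->]; rewrite mul0r.
  by rewrite mevalX; apply: eq_bigr => i _; rewrite ffunE.
have [k [p [u [pinc pu eu Xvan]]]] := vanishing_diagonal nstd.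
have uinj : injective u.
  move=> i j uij; have pij : tnth p i = tnth p j by rewrite -!pu uij.
  by case: (ltngtP i j) => [/pinc|/pinc|/val_inj //]; rewrite pij /se ltnn.
(* The diagonal term of the minor divides the monomial, since its variables are distinct and all
   occur in [e]. *)
pose m0 : 'X_{1..m} := (\sum_i U_(u i))%MM.
have m0e : (m0 <= e)%MM.
  apply/mnm_lepP => v; rewrite /m0 mnm_sumE.
  have [[i <-]|nv] := pselect (exists i, u i = v).
    rewrite (bigD1 i) //= mnm1E eqxx big1 ?addn0; first by rewrite lt0n.
    move=> j ji; rewrite mnm1E; case: eqP => // /uinj e0.
    by rewrite e0 eqxx in ji.
  rewrite big1 // => i _; rewrite mnm1E; case: eqP => // uv.
  by case: nv; exists i.
pose e1 := (e - m0)%MM; have eE : e = (e1 + m0)%MM by rewrite /e1 submK.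
have wm0 : wt m0 = (\sum_i (tnth p i).1 * (tnth p i).2)%N.
  by rewrite wt_sum; apply: eq_bigr => i _; rewrite wtU pu.
have dm0 : mdeg m0 = k.
  by rewrite mdeg_sum; under eq_bigr do rewrite mdeg1; rewrite sum1_card card_ord.
pose term (t : 'S_k) (v : 'rV[F]_m) := 'X_[e1].@[v 0] *
   (\prod_i G (tnth p i).1 (tnth p (t i)).2).@[v 0].
have Xm0 : 'X_[m0] = \prod_i G (tnth p i).1 (tnth p ((1%g : 'S_k) i)).2.
  by rewrite mpolyX_sum; apply: eq_bigr => i _; rewrite perm1 -pu Gpos.
(* The vanishing minor lets the diagonal term be replaced by minus the sum of its other terms, each
   multiplied by the cofactor [e1]. *)
apply: (@std_span_eq _ (fun v => \sum_(t <- [seq t <- enum 'S_k | t != 1%g]) - (-1) ^+ (t : 'S_k) * term t v)).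
  move=> v Xv; rewrite eE mpolyXD mevalM Xm0.
  rewrite big_filter big_enum_cond /=.
  have := Xvan v Xv; rewrite (bigD1 1%g) //= odd_perm1 expr0 mul1r mevalD => /eqP.
  rewrite addr_eq0 => /eqP ->; rewrite mulrN raddf_sum mulr_sumr -sumrN.
  apply: eq_big => [t|t _]; first by rewrite ?inE.
  rewrite /= /term mevalM rmorphXn rmorphN1 mulNr; congr (- _).
  by rewrite mulrCA.
apply: std_span_sum => t; rewrite mem_filter => /andP[t1 _].
have [z|[e2 [d2 w2 E2]]] :=
    straighten_term (fun i => (tnth p i).1) (fun i => (tnth p (t i)).2).
  by apply: std_span0 => v _; rewrite /term z mulr0.
apply: (@std_span_eq _ (fun v => 'X_[e1 + e2].@[v 0])).
  by move=> v _; rewrite /term mpolyXD mevalM E2.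
apply: IH; last by move: eD; rewrite eE !mdegD d2 dm0.
have : (wt e2 < wt m0)%N.
  rewrite w2 wm0; apply: (@rearrangement _ (fun i => val (tnth p i).1) (fun i => val (tnth p i).2)) => //.
    by move=> i j /pinc/andP[].
  by move=> i j /pinc/andP[].
by move: eN; rewrite eE !wtD; lia.
Qed.

Lemma std_span_poly D q : (msize q <= D.+1)%N -> std_span D (fun v => q.@[v 0]).
Proof.
move=> qD; apply: (@std_span_eq _ (fun v => \sum_(e <- msupp q) q@_e * 'X_[e].@[v 0])).
  move=> v _; rewrite [in RHS](mpolyE q) raddf_sum; apply: eq_bigr => e _.
  by rewrite /= mevalZ.
apply: std_span_sum => e eq; apply: std_span_monomial.
by rewrite -ltnS; apply: leq_trans qD; apply: msize_mdeg_lt.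
Qed.

(** There are at most 2^m supports, each with at most [d] variables and hence at most (D + 1)^d
    families of exponents. *)
Lemma card_standard D :
  (#|[set e : {ffun 'I_m -> 'I_D.+1} |
      `[< standard [multinom val (e i) | i < m] >]]%SET| <= 2 ^ m * D.+1 ^ d)%N.
Proof.
pose C (V : {set 'I_m}) : {set {ffun 'I_m -> 'I_D.+1}} :=
  [set e in pffun_on ord0 V predT]%SET.
apply: (@leq_trans #|\bigcup_(V : {set 'I_m} | (#|V| <= d)%N) C V|).
  apply: subset_leq_card; apply/fintype.subsetP => e; rewrite inE => /asboolP std.
  apply/bigcupP; exists (msupport [multinom val (e i) | i < m]); first exact: avoids_le.
  rewrite inE; apply/pffun_onP; split=> //.
  by apply/fintype.subsetP => i; rewrite !inE mnmE.
apply: (@leq_trans (\sum_(V : {set 'I_m} | (#|V| <= d)%N) #|C V|)%N).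
  elim/big_rec2: _ => [|V k B _ le]; first by rewrite cards0.
  by apply: leq_trans (leq_card_setU _ _) _; rewrite leq_add2l.
apply: (@leq_trans (\sum_(V : {set 'I_m}) D.+1 ^ d)%N); last first.
  by rewrite sum_nat_const -cardsT -powersetT card_powerset cardsT card_ord.
rewrite [leqRHS](bigID (fun V : {set 'I_m} => (#|V| <= d)%N)) /=.
apply: leq_trans (leq_addr _ _); apply: leq_sum => V Vd.
by rewrite cardsE card_pffun_on card_ord leq_pexp2l.
Qed.

(** The (K + 1)^(d + 1) products of powers of the [g i] with exponents at most K lie in a span whose
    dimension grows only like K^d, so for large K they are linearly dependent on [X]. *)
Lemma trdeg_le_fulton : trdeg_le X d.
Proof.
move=> g; pose E := \max_i msize (g i).
(* [D] bounds the degree of the products. As D + 1 <= ((d + 1) E + 1)(K + 1), there are at most K (K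
   + 1)^d standard monomials, fewer than (K + 1)^(d + 1). *)
pose K := (2 ^ m * (d.+1 * E).+1 ^ d)%N; pose D := (d.+1 * (K * E))%N.
exists K.
have msize_prod (I : Type) (r : seq I) (q : I -> {mpoly F[m]}) b :
    (forall i, msize (q i) <= b.+1)%N -> (msize (\prod_(i <- r) q i) <= (size r * b).+1)%N.
  move=> qb; elim: r => [|i r IH]; first by rewrite big_nil msize1.
  rewrite big_cons /=; have [->|q0] := eqVneq (q i) 0; first by rewrite mul0r msize0.
  have [->|r0] := eqVneq (\prod_(j <- r) q j) 0; first by rewrite mulr0 msize0.
  have aux (x y z : nat) : (x <= b.+1 -> y <= z.+1 -> (x + y).-1 <= (b + z).+1)%N by lia.
  by rewrite msizeM // mulSn; apply: aux.
have span (a : {ffun 'I_d.+1 -> 'I_K.+1}) :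
    std_span D (fun v => \prod_i (g i).@[v 0] ^+ a i).
  apply: (@std_span_eq _ (fun v => (\prod_i g i ^+ a i).@[v 0])).
    by move=> v _; rewrite rmorph_prod; apply: eq_bigr => i _; rewrite rmorphXn.
  apply: std_span_poly; have := @msize_prod _ (index_enum 'I_d.+1) (fun i => g i ^+ a i) (K * E)%N.
  have sz : size (index_enum 'I_d.+1) = d.+1 by rewrite -sum1_size sum1_card card_ord.
  rewrite sz; apply => i.
  rewrite -[X in _ ^+ X]card_ord -prodr_const -big_enum /=.
  apply: leq_trans (msize_prod _ _ (fun=> g i) E _) _.
    by move=> _; rewrite leqW // /E; apply: (@leq_bigmax _ (fun i => msize (g i))).
  by rewrite -cardE card_ord ltnS leq_mul2r -ltnS ltn_ord orbT.
have [A hA] := choice span.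
have [|c [c0 hc]] := @linear_relation F _ _
   [set e : {ffun 'I_m -> 'I_D.+1} | `[< standard [multinom val (e i) | i < m] >]]%SET A.
  apply: leq_ltn_trans (card_standard D) _; rewrite card_ffun !card_ord expnS.
  have le : (D.+1 <= (d.+1 * E).+1 * K.+1)%N by rewrite /D; nia.
  have pw (x y e : nat) : (x <= y -> x ^ e <= y ^ e)%N by case: e => // e; rewrite leq_exp2r.
  apply: (@leq_ltn_trans (2 ^ m * ((d.+1 * E).+1 * K.+1) ^ d)%N).
    by rewrite leq_mul2l pw ?orbT.
  by rewrite expnMn mulnA -/K ltn_mul2r expn_gt0 ltnS leqnn.
exists c; split=> // v Xv.
under eq_bigr => a _ do rewrite hA // big_distrr /=.
rewrite exchange_big /= big1 // => e std.
have := hc e; rewrite inE std => /(_ isT) he.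
under eq_bigr => a _ do rewrite mulrA.
by rewrite -mulr_suml he mul0r.
Qed.

End UpperBound.

(** * Ranks and Bruhat cells *)

Section Rank.
Variable F : fieldType.

Lemma det_mxsub_rank k p q (f : 'I_k -> 'I_p) (g : 'I_k -> 'I_q) (N : 'M[F]_(p, q)) :
  (\rank N < k)%N -> \det (mxsub f g N) = 0.
Proof.
move=> rk; apply/eqP; apply: contraTT rk => d0; rewrite -leqNgt.
have : mxsub f g N \in unitmx by rewrite unitmxE unitfE.
rewrite -row_full_unit /row_full => /eqP {1}<-.
pose P : 'M[F]_(k, p) := \matrix_(i, j) (f i == j)%:R.
pose Q : 'M[F]_(q, k) := \matrix_(i, j) (g j == i)%:R.
have -> : mxsub f g N = P *m N *m Q.
  apply/matrixP => i j; rewrite !mxE (bigD1 (g j)) //= !mxE eqxx mulr1.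
  rewrite (bigD1 (f i)) //= !mxE eqxx mul1r [X in _ + X + _]big1 ?addr0.
    rewrite big1 ?addr0 // => l lg; rewrite [X in _ * X]mxE.
    by rewrite eq_sym (negbTE lg) mulr0.
  by move=> l lf; rewrite mxE eq_sym (negbTE lf) mul0r.
by apply: leq_trans (mxrankM_maxl _ _) _; apply: mxrankM_maxr.
Qed.

Lemma det_mxsub_neq0 p q (N : 'M[F]_(p, q)) :
  exists (f : 'I_(\rank N) -> 'I_p) (g : 'I_(\rank N) -> 'I_q), \det (mxsub f g N) != 0.
Proof.
pose f := maxrankfun N.
have full : row_full (rowsub f N)^T.
  by rewrite /row_full mxrank_tr; apply: maxrowsub_free.
exists f, (fullrankfun full).
have := fullrowsub_unit full; rewrite unitmxE unitfE -det_tr.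
by congr (\det _ != 0); apply/matrixP => i j; rewrite !mxE.
Qed.

Variable n : nat.
Implicit Types (M U : 'M[F]_n) (w : 'S_n) (a b : 'I_n).

Definition upper U := forall i j : 'I_n, (j < i)%N -> U i j = 0.

Lemma upperM U V : upper U -> upper V -> upper (U *m V).
Proof.
move=> hU hV i j ji; rewrite mxE big1 // => k _.
have [ki|ik] := ltnP k i; first by rewrite hU ?mul0r.
by rewrite hV ?mulr0 //; apply: leq_trans ik.
Qed.

Lemma borelM U V : borel U -> borel V -> borel (U *m V).
Proof.
by move=> [uU hU] [uV hV]; split; [rewrite unitmx_mul uU|apply: upperM].
Qed.

(** The rows of [U] from [a] on vanish left of column [a], so the block of the product is a block of
    [U] times the block of [M]. *)
Lemma swrank_mull U M a b : upper U -> (swrank (U *m M) a b <= swrank M a b)%N.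
Proof.
move=> hU; rewrite /swrank.
have -> : swsub a b (U *m M) =
    (mxsub enum_val enum_val U : 'M_(#|[pred i : 'I_n | (a <= i)%N]|)) *m swsub a b M.
  apply/matrixP => i j; rewrite !mxE (bigID [pred k : 'I_n | (a <= k)%N]) /= addrC.
  rewrite big1 ?add0r.
    by rewrite big_enum_val /=; apply: eq_bigr => k _; rewrite !mxE.
  move=> k; rewrite -ltnNge => ka; rewrite hU ?mul0r //.
  by apply: leq_trans ka _; have := enum_valP i.
exact: mxrankM_maxr.
Qed.

Lemma swrank_mulr U M a b : upper U -> (swrank (M *m U) a b <= swrank M a b)%N.
Proof.
move=> hU; rewrite /swrank.
have -> : swsub a b (M *m U) = swsub a b M *m
    (mxsub enum_val enum_val U : 'M_(#|[pred i : 'I_n | (i <= b)%N]|)).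
  apply/matrixP => i j; rewrite !mxE (bigID [pred k : 'I_n | (k <= b)%N]) /= addrC.
  rewrite big1 ?add0r.
    by rewrite big_enum_val /=; apply: eq_bigr => k _; rewrite !mxE.
  move=> k; rewrite -ltnNge => kb; rewrite hU ?mulr0 //.
  by apply: leq_ltn_trans kb; have := enum_valP j.
exact: mxrankM_maxl.
Qed.

Lemma upper_unit U : upper U -> (U \in unitmx) = [forall i, U i i != 0].
Proof.
move=> hU; rewrite unitmxE unitfE -det_tr det_trig; last first.
  by apply/is_trig_mxP => i j ij; rewrite mxE hU.
apply/idP/forallP => [/prodf_neq0 h i|h].
  by have := h i isT; rewrite mxE.
by apply/prodf_neq0 => i _; rewrite mxE.
Qed.

Lemma upper_inv U : borel U -> upper (invmx U).
Proof.
move=> [uU hU] i j; have := uU; rewrite (upper_unit hU) => /forallP dU.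
have [m] := ubnP j; elim: m j => // m IH j; rewrite ltnS => jm ji.
have := congr1 (fun A : 'M_n => A i j) (mulVmx uU).
rewrite !mxE (bigD1 j) //= [i == j]gtn_eqF // big1 ?addr0.
  by move/eqP; rewrite mulf_eq0 (negbTE (dU j)) orbF => /eqP.
move=> k kj; have [jk|kj'] := ltnP j k; first by rewrite hU ?mulr0.
have ltkj : (k < j)%N by rewrite ltn_neqAle kj' andbT.
by rewrite IH ?mul0r //; [apply: leq_trans ltkj jm|apply: ltn_trans ltkj ji].
Qed.

Lemma swrank_bruhat w M a b : bruhat_cell F w M -> swrank M a b = swrank (wmx F w) a b.
Proof.
move=> [b1 [b2 [hb1 hb2 ->]]]; apply/eqP; rewrite eqn_leq; apply/andP; split.
  rewrite (leq_trans (swrank_mulr _ _ _ hb2.2)) // swrank_mull //; exact: hb1.2.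
have E : wmx F w = invmx b1 *m (b1 *m wmx F w *m b2) *m invmx b2.
  by rewrite !mulmxA mulVmx ?mul1mx ?mulmxK //; [exact: hb2.1|exact: hb1.1].
rewrite {1}E (leq_trans (swrank_mulr _ _ _ (upper_inv hb2))) //.
by rewrite swrank_mull //; apply: upper_inv.
Qed.

(** The block factors as [P *m Q] through the set [B] of its 1s, where [P] has a left inverse and
    [Q] a right inverse. *)
Lemma swrank_wmx w a b : swrank (wmx F w) a b = cnt w b.+1 a.
Proof.
pose B := [set j : 'I_n | (j < b.+1)%N && (a <= w j)%N]%SET.
have -> : cnt w b.+1 a = #|B|.
  rewrite -sum1_card big_mkcond; apply: eq_bigr => j _; rewrite inE.
  by case: (_ && _).
pose P : 'M[F]_(#|[pred i : 'I_n | (a <= i)%N]|, #|B|) :=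
  \matrix_(i, k) (enum_val i == w (enum_val k))%:R.
pose Q : 'M[F]_(#|B|, #|[pred j : 'I_n | (j <= b)%N]|) :=
  \matrix_(k, j) (enum_val k == enum_val j)%:R.
have E : swsub a b (wmx F w) = P *m Q.
  apply/matrixP => i j; rewrite !mxE.
  transitivity (\sum_(k in B) (enum_val i == w k)%:R * (k == enum_val j)%:R : F); last first.
    by rewrite big_enum_val; apply: eq_bigr => k _; rewrite !mxE.
  have [jB|jB] := boolP (enum_val j \in B).
    rewrite (bigD1 (enum_val j)) //= eqxx mulr1 big1 ?addr0 // => k /andP[_ /negbTE ->].
    by rewrite mulr0.
  rewrite big1; last first.
    by move=> k kB; case: (k =P enum_val j) => [kj|_]; [rewrite -kj kB in jB|rewrite mulr0].
  case: eqP => // wj; case/negP: jB; rewrite inE ltnS -wj.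
  by apply/andP; split; [have := enum_valP j|have := enum_valP i].
have PP : P^T *m P = 1%:M.
  apply/matrixP => k l; rewrite !mxE.
  have kB : w (enum_val k) \in [pred i : 'I_n | (a <= i)%N].
    by have := enum_valP k; rewrite inE => /andP[].
  rewrite (bigD1 (enum_rank_in kB (w (enum_val k)))) //= !mxE enum_rankK_in // eqxx mul1r.
  rewrite big1 ?addr0; first by rewrite (inj_eq perm_inj) (inj_eq enum_val_inj).
  move=> i /eqP ik; rewrite !mxE; case: eqP => [e|_]; rewrite ?mul0r //.
  by case: ik; apply: enum_val_inj; rewrite enum_rankK_in.
have QQ : Q *m Q^T = 1%:M.
  apply/matrixP => k l; rewrite !mxE.
  have kB : enum_val k \in [pred j : 'I_n | (j <= b)%N].
    by have := enum_valP k; rewrite inE ltnS => /andP[].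
  rewrite (bigD1 (enum_rank_in kB (enum_val k))) //= !mxE enum_rankK_in // eqxx mul1r.
  rewrite big1 ?addr0; first by rewrite eq_sym (inj_eq enum_val_inj).
  move=> i /eqP ik; rewrite !mxE; case: eqP => [e|_]; rewrite ?mul0r //.
  by case: ik; apply: enum_val_inj; rewrite enum_rankK_in.
apply/eqP; rewrite eqn_leq /swrank E (leq_trans (mxrankM_maxl _ _)) ?rank_leq_col //=.
rewrite -{1}(mxrank1 F #|B|).
have <- : P^T *m (P *m Q) *m Q^T = 1%:M by rewrite mulmxA PP mul1mx QQ.
by apply: leq_trans (mxrankM_maxl _ _) _; apply: mxrankM_maxr.
Qed.

End Rank.

(** * Reduced words and products of elementary matrices *)

Section ReducedWords.
Variables (F : fieldType) (n : nat).
Implicit Types (w : 'S_n) (i j : 'I_n) (s : seq ('I_n * 'I_n)) (t : nat -> F).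

(* Words are read from right to left: the head of the list is the last letter.
   The letter (i, i.+1) stands for the transposition of i and i.+1. *)
Fixpoint word_perm s : 'S_n :=
  if s is p :: s' then (tperm p.1 p.2 * word_perm s')%g else 1%g.

Fixpoint reduced s : bool :=
  if s is p :: s' then
    [&& p.2 == p.1.+1 :> nat, (word_perm s' p.1 < word_perm s' p.2)%N & reduced s']
  else true.

(** Undoing a descent of [w] adds exactly one non-inversion, until the identity is reached. *)
Lemma reduced_word w : exists s,
  [/\ reduced s, word_perm s = w & (size s + #|noninvs w| = 'C(n, 2))%N].
Proof.
have [m] := ubnP (n * n - #|noninvs w|)%N; elim: m w => // m IH w wm.
have [->|/perm_descent[i [j [ij wji]]]] := eqVneq w 1%g.
  by exists [::]; split=> //; rewrite card_noninvs1.
pose w' := (tperm i j * w)%g.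
have w'ij : (w' i < w' j)%N by rewrite !permM tpermL tpermR.
have ww' : w = (tperm i j * w')%g by rewrite mulgA tperm2 mul1g.
have c : #|noninvs w'| = #|noninvs w|.+1 by have := card_noninvs_ascent ij w'ij; rewrite -ww'.
have le : (#|noninvs w'| <= n * n)%N.
  by apply: leq_trans (max_card _) _; rewrite card_prod card_ord.
have [|s [rs sw sz]] := IH w'; first by lia.
exists ((i, j) :: s); split=> /=; first by rewrite ij eqxx sw w'ij.
  by rewrite sw -ww'.
by rewrite -sz c addSnnS.
Qed.

(** The head of the list carries the highest parameter index, so setting the last parameters to 0
    deletes letters at the head (see [word_mx_drop]). *)
Fixpoint word_mx s t : 'M[F]_n :=
  if s is p :: s' then
    word_mx s' t *m (1%:M + t (size s') *: delta_mx p.2 p.1)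
  else 1%:M.

Lemma unit_transvection i j (c : F) : i != j -> 1%:M + c *: delta_mx i j \in unitmx.
Proof.
move=> ij; have /mulmx1_unit[] // : (1%:M + c *: delta_mx i j) *m (1%:M - c *: delta_mx i j) = 1%:M.
rewrite mulmxDl !mulmxBr !mulmx1 mul1mx -scalemxAl -scalemxAr mul_delta_mx_0 1?eq_sym //.
by rewrite !scaler0 subr0 subrK.
Qed.

Lemma wmx_perm w : wmx F w = perm_mx (w^-1)%g.
Proof.
apply/matrixP => i j; rewrite !mxE; congr ((nat_of_bool _)%:R).
by apply/eqP/eqP => [->|<-]; rewrite ?permK ?permKV.
Qed.

(** The matrix [b2 *m (1%:M + c *: delta_mx j i)] has a single nonzero entry below the diagonal, at
    [(j, i)]. It factors as 1 + a E_ij, the transposition, and an upper triangular matrix; since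
    [w i < w j], passing the first factor through [w] gives the upper triangular 1 + a E_(w i, w
    j). *)
Lemma bruhat_step w i j (c : F) M : j = i.+1 :> nat -> (w i < w j)%N -> c != 0 ->
  bruhat_cell F w M ->
  bruhat_cell F (tperm i j * w)%g (M *m (1%:M + c *: delta_mx j i)).
Proof.
move=> ij wij c0 [b1 [b2 [hb1 [ub2 hb2] ->]]].
have nij : i != j by rewrite -val_eqE /= ij; lia.
have [g gdef] : exists g : 'M[F]_n, g = b2 *m (1%:M + c *: delta_mx j i) by eexists.
have gE k l : g k l = b2 k l + (l == i)%:R * (c * b2 k j).
  rewrite gdef mulmxDr mulmx1 -scalemxAr !mxE; congr (_ + _).
  rewrite (bigD1 j) //= !mxE eqxx /= big1 ?addr0 1?[in RHS]mulrC.
    by rewrite mulrA.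
  by move=> k' /negbTE k'j; rewrite mxE k'j mulr0.
have b2jj : b2 j j != 0 by have := ub2; rewrite (upper_unit hb2) => /forallP.
have gji : g j i != 0 by rewrite gE hb2 ?ij // add0r eqxx mul1r mulf_neq0.
have glow (k l : 'I_n) : (l < k)%N -> (l != i) || (k != j) -> g k l = 0.
  move=> lk lkij; rewrite gE hb2 // add0r; case: eqP => [li|_]; last by rewrite mul0r.
  rewrite hb2 ?mulr0 //; rewrite li eqxx /= in lkij lk.
  by move: lkij; rewrite -val_eqE /= ij in lk *; lia.
(* This multiple of row [j] clears the entry [(i, i)]; exchanging the two rows then gives an upper
   triangular matrix. *)
pose a := g i i / g j i.
pose h := (1%:M - a *: delta_mx i j) *m g.
have hE k l : h k l = g k l - (k == i)%:R * (a * g j l).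
  rewrite /h mulmxBl mul1mx -scalemxAl !mxE; congr (_ - _).
  rewrite (bigD1 j) //= !mxE eqxx andbT big1 ?addr0; first by rewrite mulrCA.
  by move=> k' /negbTE k'j; rewrite mxE k'j andbF mul0r.
pose b' := tperm_mx i j *m h.
have b'E k l : b' k l = h (tperm i j k) l.
  by rewrite /b' /tperm_mx -row_permE mxE.
have ug : g \in unitmx by rewrite gdef unitmx_mul ub2 unit_transvection // eq_sym.
have uT (x : F) : 1%:M - x *: delta_mx i j \in unitmx.
  by rewrite -scaleNr unit_transvection.
have hb' : borel b'.
  split; first by rewrite !unitmx_mul unitmx_perm ug uT.
  move=> k l lk; rewrite b'E hE; case: tpermP => [ki|kj|/eqP ki /eqP kj].
  - rewrite eq_sym (negbTE nij) mul0r subr0 glow //; rewrite ki in lk; first by lia.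
    by rewrite -val_eqE /=; apply/orP; left; lia.
  - rewrite eqxx mul1r; have [li|li] := eqVneq l i.
      by rewrite li /a mulfVK ?subrr.
    rewrite kj in lk; have lti : (l < i)%N.
      by rewrite ltn_neqAle -val_eqE /= in li *; lia.
    by rewrite !glow ?mulr0 ?subr0 ?li //; lia.
  - by rewrite (negbTE ki) mul0r subr0 glow // kj orbT.
have gE' : g = (1%:M + a *: delta_mx i j) *m tperm_mx i j *m b'.
  rewrite /b' -!mulmxA [tperm_mx i j *m (tperm_mx i j *m h)]mulmxA -perm_mxM tperm2 perm_mx1 mul1mx.
  rewrite /h mulmxA mulmxDl mul1mx -scalemxAl mulmxBr mulmx1 -scalemxAr mul_delta_mx_0; last by rewrite eq_sym.
  by rewrite scaler0 subr0 subrK mul1mx.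
clearbody b'; exists (b1 *m (1%:M + a *: delta_mx (w i) (w j))), b'; split=> //.
  apply: borelM => //; split; first by rewrite unit_transvection // (inj_eq perm_inj).
  move=> k l lk; rewrite !mxE -val_eqE /= [k == l :> nat]gtn_eqF // add0r.
  case: eqP => [ki|_]; last by rewrite mulr0.
  case: eqP => [lj|_]; last by rewrite mulr0.
  by move: lk wij; rewrite ki lj; lia.
rewrite -!mulmxA -gdef gE' !mulmxA; congr (_ *m _).
rewrite -!mulmxA; congr (_ *m _).
have comm : wmx F w *m (1%:M + a *: delta_mx i j) =
            (1%:M + a *: delta_mx (w i) (w j)) *m wmx F w.
  rewrite mulmxDl mulmxDr mulmx1 mul1mx; congr (_ + _).
  rewrite -scalemxAl -scalemxAr; congr (_ *: _); apply/matrixP => k l; rewrite !mxE.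
  rewrite (bigD1 i) //= big1 ?addr0; last first.
    by move=> x /negbTE xi; rewrite !mxE xi mulr0.
  rewrite (bigD1 (w j)) //= big1 ?addr0; last first.
    by move=> x /negbTE xi; rewrite !mxE xi andbF mul0r.
  by rewrite !mxE !eqxx ?andbT (inj_eq perm_inj) [l == j]eq_sym.
rewrite mulmxA comm -mulmxA; congr (_ *m _).
by rewrite !wmx_perm invMg tpermV perm_mxM.
Qed.

Lemma word_mx_bruhat s t : reduced s -> (forall k, (k < size s)%N -> t k != 0) ->
  bruhat_cell F (word_perm s) (word_mx s t).
Proof.
elim: s => [_ _|p s IH] /=.
  exists 1%:M, 1%:M; rewrite wmx_perm invg1 perm_mx1 !mulmx1; split=> //;
  by split; [exact: unitmx1|move=> i j ji; rewrite mxE -val_eqE /= gtn_eqF].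
move=> /and3P[/eqP pp wp rs] ht; apply: bruhat_step => //; first exact: ht.
by apply: IH => // k ks; apply: ht; apply: leq_trans ks _.
Qed.

Lemma word_mx_lower s t : reduced s -> word_mx s t \in unitmx /\ upper (word_mx s t)^T.
Proof.
elim: s => [_|p s IH] /=.
  by split; [exact: unitmx1|move=> i j ji; rewrite !mxE -val_eqE /= ltn_eqF].
move=> /and3P[/eqP pp wp /IH[u l]]; split.
  rewrite unitmx_mul u unit_transvection //; rewrite -val_eqE /= pp; lia.
rewrite trmx_mul; apply: upperM => // i j ji.
rewrite !mxE -!val_eqE /= ltn_eqF // add0r.
case: eqP => [jp|_]; last by rewrite mulr0.
case: eqP => [ip|_]; last by rewrite mulr0.
by move: ji; rewrite jp ip pp; lia.
Qed.

Lemma word_mx_drop s t (j : nat) : (j <= size s)%N -> (forall k, (j <= k)%N -> t k = 0) ->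
  word_mx s t = word_mx (drop (size s - j) s) t.
Proof.
elim: s => [|p s IH] //= js ht; have [ltj|] := ltnP (size s) j.
  have -> : j = (size s).+1 by apply/eqP; rewrite eqn_leq js.
  by rewrite subnn.
move=> jle; rewrite (subSn jle) /= ht // scale0r addr0 mulmx1; exact: IH.
Qed.

Lemma reduced_drop s k : reduced s -> reduced (drop k s).
Proof. by elim: s k => [|p s IH] [|k] //= /and3P[_ _ /IH]; apply. Qed.

End ReducedWords.

(** * Lower bound on the dimension *)

Section LowerBound.
Variables (F : numFieldType) (n m : nat) (G : 'M[{mpoly F[m]}]_n).
Variables (N0 : nat) (ps : 'I_N0 -> 'I_n * 'I_n) (sym : bool).
Hypothesis ps_inj : injective ps.
Hypothesis ps_upper : forall k, ((ps k).1 <= (ps k).2)%N.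
Hypothesis ps_diag : forall i, exists k, ps k = (i, i).
Variable s : seq ('I_n * 'I_n).
Hypothesis red : reduced s.

Let d := (N0 + size s)%N.
Implicit Types x : 'rV[F]_d.

(* Extended by 0 to all natural numbers. *)
Definition xcoord x k : F := if insub k is Some i then x 0 i else 0.
Definition end_mx x : 'M[F]_n := \sum_(k < N0) xcoord x k *: delta_mx (ps k).1 (ps k).2.
Definition left_mx x := word_mx s (fun k => xcoord x (N0 + k)).

(* L E for the full and the lower triangular matrices, L E L^T for the symmetric
   ones, where L is the product of the elementary matrices of the word s. *)
Definition param_mx x : 'M[F]_n :=
  left_mx x *m end_mx x *m (if sym then (left_mx x)^T else 1%:M).

Definition eval_mx (v : 'rV[F]_m) : 'M[F]_n := map_mx (meval (v 0)) G.

Variable psi : 'rV[F]_d -> 'rV[F]_m.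
Hypothesis psi_entry : forall j, exists p : 'I_n * 'I_n, forall x, psi x 0 j = param_mx x p.1 p.2.
Hypothesis psiK : forall x, eval_mx (psi x) = param_mx x.
Variable X : set 'rV[F]_m.
Hypothesis closedX : zclosed X.
Hypothesis psiX : forall x, bruhat_cell F (word_perm s) (param_mx x) -> X (psi x).

Let polyfun_coord' k : polyfun (fun x => xcoord x k).
Proof.
rewrite /xcoord; case: insubP => [i _ _|_]; [exact: polyfun_coord|exact: polyfun_cst].
Qed.

Let polyfun_mulmx p q r (A : 'rV[F]_d -> 'M[F]_(p, q)) (B : 'rV[F]_d -> 'M[F]_(q, r)) :
  (forall i j, polyfun (fun x => A x i j)) -> (forall i j, polyfun (fun x => B x i j)) ->
  forall i j, polyfun (fun x => (A x *m B x) i j).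
Proof.
move=> hA hB i j.
have [P hP] := polyfun_sum (fun k => polyfunM (hA i k) (hB k j)).
by exists P => x; rewrite mxE hP.
Qed.

Let polyfun_left i j : polyfun (fun x => left_mx x i j).
Proof.
rewrite /left_mx; elim: (s) i j => [|p s' IH] i j /=; first exact: polyfun_cst.
apply: polyfun_mulmx => // k l.
have [P hP] := polyfunD (polyfun_cst d ((1%:M : 'M[F]_n) k l))
  (polyfunM (polyfun_coord' (N0 + size s')) (polyfun_cst d ((delta_mx p.2 p.1 : 'M[F]_n) k l))).
by exists P => x; rewrite -hP !mxE.
Qed.

Let polyfun_end i j : polyfun (fun x => end_mx x i j).
Proof.
have [P hP] := polyfun_sum (fun k : 'I_N0 => polyfunM (polyfun_coord' k)
  (polyfun_cst d ((delta_mx (ps k).1 (ps k).2 : 'M[F]_n) i j))).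
by exists P => x; rewrite -hP summxE; apply: eq_bigr => k _; rewrite mxE.
Qed.

Let polyfun_psi j : polyfun (fun x => psi x 0 j).
Proof.
have [p hp] := psi_entry j.
suff [P hP] : polyfun (fun x => param_mx x p.1 p.2) by exists P => x; rewrite hp.
rewrite /param_mx; apply: polyfun_mulmx; first exact: polyfun_mulmx polyfun_left polyfun_end.
case: sym => i k; last exact: polyfun_cst.
have [P hP] := polyfun_left k i; by exists P => x; rewrite mxE.
Qed.

Let coordE x (i : 'I_d) : xcoord x i = x 0 i.
Proof. by rewrite /xcoord insubT ?ltn_ord // => h; congr (x 0 _); apply: val_inj. Qed.

Let coord_sub k x i : coord_subspace k x -> (k <= i)%N -> xcoord x i = 0.
Proof.
by move=> hx ki; rewrite /xcoord; case: insubP => // i' _ e; apply: hx; rewrite e.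
Qed.

Let end_entry x k : end_mx x (ps k).1 (ps k).2 = xcoord x k.
Proof.
rewrite summxE (bigD1 k) //= big1 ?addr0; first by rewrite !mxE !eqxx mulr1.
move=> l lk; rewrite !mxE; case: eqP => [e1|_]; last by rewrite mulr0.
case: eqP => [e2|_]; last by rewrite mulr0.
by case/eqP: lk; apply: ps_inj; rewrite [ps l]surjective_pairing -e1 -e2 -surjective_pairing.
Qed.

Let upper_end x : upper (end_mx x).
Proof.
move=> i j ji; rewrite summxE big1 // => k _; rewrite !mxE.
case: eqP => [e1|_]; last by rewrite mulr0.
case: eqP => [e2|_]; last by rewrite mulr0.
by have := ps_upper k; rewrite leqNgt -e1 -e2 ji.
Qed.

Let borel_end x : (forall k : 'I_N0, xcoord x k != 0) -> borel (end_mx x).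
Proof.
move=> hx; split; last exact: upper_end.
rewrite (upper_unit (upper_end x)); apply/forallP => i.
by have [k hk] := ps_diag i; have := end_entry x k; rewrite hk /= => ->.
Qed.

Let left_drop j x : (j <= size s)%N -> coord_subspace (N0 + j) x ->
  left_mx x = word_mx (drop (size s - j) s) (fun k => xcoord x (N0 + k)).
Proof.
move=> js hx; apply: word_mx_drop => // k jk.
by apply: coord_sub hx _; rewrite leq_add2l.
Qed.

Let param_bruhat j x : (j <= size s)%N -> coord_subspace (N0 + j) x ->
  (forall k, (k < N0 + j)%N -> xcoord x k != 0) ->
  bruhat_cell F (word_perm (drop (size s - j) s)) (param_mx x).
Proof.
move=> js hx nz; rewrite /param_mx (left_drop js hx).
set sj := drop _ s; set t := fun k => _.
have rj : reduced sj := reduced_drop _ red.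
have sz : size sj = j by rewrite size_drop subKn.
have [|b1 [b2 [hb1 hb2 e]]] := @word_mx_bruhat F n sj t rj.
  by move=> k; rewrite sz => kj; apply: nz; rewrite ltn_add2l.
have hE : borel (end_mx x).
  by apply: borel_end => k; apply: nz; apply: leq_trans (ltn_ord k) (leq_addr _ _).
have hR : borel (if sym then (word_mx sj t)^T else 1%:M).
  have [u l] := word_mx_lower t rj.
  case: sym; first by split; rewrite ?unitmx_tr.
  by split; [exact: unitmx1|move=> i k ki; rewrite mxE -val_eqE /= gtn_eqF].
move: hR; set R := (if sym then _ else _) => hR.
exists b1, (b2 *m end_mx x *m R); split=> //; first by apply: borelM => //; apply: borelM.
by rewrite e !mulmxA.
Qed.

Let det_eval k a b (f : 'I_k -> _) (g : 'I_k -> _) v :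
  \det (mxsub f g (swsub a b (eval_mx v))) = (\det (mxsub f g (swsub a b G))).@[v 0].
Proof. by rewrite -det_map_mx !map_mxsub. Qed.

Let zclosed_rank a b r : zclosed [set v | (swrank (eval_mx v) a b <= r)%N].
Proof.
exists [set p | exists k (f : 'I_k -> _) (g : 'I_k -> _),
  (r < k)%N /\ p = \det (mxsub f g (swsub a b G))].
apply/seteqP; split=> v /= hv.
  move=> _ [k [f [g [rk ->]]]]; rewrite -det_eval.
  exact: det_mxsub_rank (leq_ltn_trans hv rk).
rewrite leqNgt; apply/negP => rk.
have [f [g /eqP]] := det_mxsub_neq0 (swsub a b (eval_mx v)); apply.
by rewrite det_eval; apply: hv; exists (swrank (eval_mx v) a b), f, g.
Qed.

Let prod_coord_neq0 k x : (k <= d)%N ->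
  (\prod_(i < d | (i < k)%N) xcoord x i != 0) -> forall i, (i < k)%N -> xcoord x i != 0.
Proof.
by move=> kd /prodf_neq0 h i ik; have := h (Ordinal (leq_trans ik kd)); apply.
Qed.

Let ones k : 'rV[F]_d := \row_i (i < k)%N%:R.

Let ones_sub k : coord_subspace k (ones k).
Proof. by move=> i ki; rewrite mxE ltnNge ki. Qed.

Let ones_neq0 k i : (k <= d)%N -> (i < k)%N -> xcoord (ones k) i != 0.
Proof.
move=> kd ik; have id := leq_trans ik kd.
by have := coordE (ones k) (Ordinal id) => /= ->; rewrite mxE ik oner_eq0.
Qed.

(** The points whose first [k] coordinates are all nonzero are dense in the coordinate subspace. *)
Let generic_image k Y : (k <= d)%N -> zclosed Y ->
  (forall x, coord_subspace k x -> (forall i, (i < k)%N -> xcoord x i != 0) -> Y (psi x)) ->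
  psi @` coord_subspace k `<=` Y.
Proof.
move=> kd cY hY.
apply: (closed_image_dense polyfun_psi (prime_coord_subspace F kd)
  (f := fun x => \prod_(i < d | (i < k)%N) xcoord x i)) => //.
- exact: polyfun_prod.
- exists (ones k); first exact: ones_sub.
  by apply/prodf_neq0 => i ik; apply: ones_neq0.
- by move=> x hx /(prod_coord_neq0 kd); apply: hY.
Qed.

(** Before the word parameters are switched on, [left_mx] is the identity, so the matrix entry at
    [ps k] is the coordinate [k] itself: it vanishes on the smaller image only. *)
Let strict_end k : (k < N0)%N ->
  ~ psi @` coord_subspace k.+1 `<=` zclosure (psi @` coord_subspace k).
Proof.
move=> kN; pose kk := Ordinal kN.
have entry x : coord_subspace N0 x -> param_mx x (ps kk).1 (ps kk).2 = xcoord x kk.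
  move=> hx; have l1 : left_mx x = 1%:M.
    rewrite (@left_drop 0%N) ?addn0 // subn0 drop_size.
    by [].
  by rewrite /param_mx l1 trmx1 if_same mul1mx mulmx1 end_entry.
move=> /(_ (psi (ones k.+1))) h.
have kd : (k < d)%N := leq_trans kN (leq_addr _ _).
have : [set v | (G (ps kk).1 (ps kk).2).@[v 0] = 0] (psi (ones k.+1)).
  apply: (zclosure_sub (zclosed_locus _) _ (h _)); last by exists (ones k.+1).
  move=> _ [x hx <-]; have := psiK x => /matrixP/(_ (ps kk).1 (ps kk).2).
  rewrite mxE /= => ->; rewrite entry ?(coord_sub hx) //.
  by move=> i ki; apply: hx; apply: leq_trans (ltnW kN) ki.
have := psiK (ones k.+1) => /matrixP/(_ (ps kk).1 (ps kk).2); rewrite mxE /= => ->.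
rewrite entry; last by move=> i ki; apply: ones_sub; apply: leq_trans ki.
by apply/eqP/ones_neq0.
Qed.

(** Let p be the letter switched on and [u] the permutation of the remaining word. On the smaller
    image the block with corner at row [u p.2], column [p.1] has rank at most that for [u], a closed
    condition; the new letter puts a 1 at this corner and raises the rank. *)
Let strict_word j : (j < size s)%N ->
  ~ psi @` coord_subspace (N0 + j).+1 `<=` zclosure (psi @` coord_subspace (N0 + j)).
Proof.
move=> js h; have jd : ((N0 + j).+1 <= d)%N by rewrite -addnS leq_add2l.
have drop_prev (r : seq ('I_n * 'I_n)) : (j < size r)%N ->
    exists p, drop (size r - j.+1) r = p :: drop (size r - j) r.
  case: r => // p0 r' jr; have Nj : (size (p0 :: r') - j.+1 < size (p0 :: r'))%N by move: jr => /=; lia.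
  exists (nth p0 (p0 :: r') (size (p0 :: r') - j.+1)).
  by rewrite (drop_nth p0 Nj); congr (_ :: drop _ _); move: jr => /=; lia.
have [p e] := drop_prev s js.
have := reduced_drop (size s - j.+1) red; rewrite e /= => /and3P[/eqP p12 lt _].
set u := word_perm _ in lt.
pose Y : set 'rV[F]_m := [set v | (swrank (eval_mx v) (u p.2) p.1 <= cnt u p.1 (u p.2))%N].
have : Y (psi (ones (N0 + j).+1)).
  apply: (zclosure_sub (zclosed_rank _ _ _) _ (h _ _)); last first.
    by exists (ones (N0 + j).+1) => //; apply: ones_sub.
  apply: generic_image (ltnW jd) (zclosed_rank _ _ _) _ => x hx nz /=.
  rewrite psiK (swrank_bruhat _ _ (param_bruhat (ltnW js) hx nz)) swrank_wmx -/u.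
  by rewrite cntS [(u p.2 <= _)%N]leqNgt lt addn0.
rewrite /Y /= psiK (@swrank_bruhat _ _ (tperm p.1 p.2 * u)%g); last first.
  have := @param_bruhat j.+1 (ones (N0 + j).+1) js; rewrite e addnS; apply.
    exact: ones_sub.
  by move=> k; apply: ones_neq0.
rewrite swrank_wmx cntS permM tpermL leqnn addn1 leqNgt; apply/negP/negPn.
rewrite ltnS; apply: leq_sum => q _; case: (ltnP q p.1) => //= qp.
rewrite permM tpermD // -val_eqE /= gtn_eqF // p12.
exact: leq_trans qp _.
Qed.

Lemma param_zchain : exists T, zchain X d T.
Proof.
exists (fun k => zclosure (psi @` coord_subspace k)); apply: zchain_zclosure => //.
- apply: generic_image => // x hx nz; apply: psiX.
  by have := param_bruhat (leqnn _) hx nz; rewrite subnn drop0.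
- by move=> k kd; exact: (zirreducible_image polyfun_psi (prime_coord_subspace F kd)).
- move=> k kd; split.
    by move=> _ [x hx <-]; exists x => // i ki; apply: hx; apply: ltnW.
  have [kN|Nk] := ltnP k N0; first exact: strict_end.
  by rewrite -(subnKC Nk); apply: strict_word; rewrite ltn_subLR.
Qed.

End LowerBound.

(** * The three varieties *)

Section Dimensions.
Variables (F : numFieldType) (n : nat) (w : 'S_n) (s : seq ('I_n * 'I_n)).
Hypothesis red : reduced s.
Hypothesis sw : word_perm s = w.
Hypothesis ssz : (size s + #|noninvs w| = 'C(n, 2))%N.

Lemma square_bin2 : (n * n = n + 'C(n, 2) + 'C(n, 2))%N.
Proof. by elim: n => // k IH; rewrite binS bin1; lia. Qed.

Lemma zclosed_fulton m (G : 'M[{mpoly F[m]}]_n) : zclosed (fulton_variety w G).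
Proof. by eexists. Qed.

Lemma bruhat_fulton m (G : 'M[{mpoly F[m]}]_n) v :
  bruhat_cell F w (eval_mx G v) -> fulton_variety w G v.
Proof.
move=> hM _ [r hr ->]; rewrite raddf_sum big1_seq // => c /hr [ab _ hmin].
rewrite /= mevalM; have [f [g [_ _ ->]]] := hmin.
rewrite -det_map_mx !map_mxsub -/(eval_mx G v) det_mxsub_rank ?mulr0 //.
by rewrite ltnS -(swrank_bruhat _ _ hM).
Qed.

Section Triangular.

Let pos (v : 'I_#|{: low_pos n}|) : 'I_n * 'I_n := val (enum_val v : low_pos n).

Let pos_inj : injective pos.
Proof. by move=> u v /val_inj/enum_val_inj. Qed.

Let pos_low v : ((pos v).2 <= (pos v).1)%N.
Proof. exact: (valP (enum_val v)). Qed.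

Let low_varP (i j : 'I_n) : (j <= i)%N ->
  exists2 v, low_var F i j = 'X_v & pos v = (i, j).
Proof.
move=> ji; exists (enum_rank (Sub (i, j) ji : low_pos n)).
  by rewrite /low_var insubT.
by rewrite /pos enum_rankK SubK.
Qed.

Let low_var0 (i j : 'I_n) : (i < j)%N -> low_var F i j = 0.
Proof. by move=> ij; rewrite /low_var insubN // -ltnNge. Qed.

Let low_var_pos v : low_var F (pos v).1 (pos v).2 = 'X_v.
Proof.
have [u -> pu] := low_varP (pos_low v).
by congr 'X_(_); apply: pos_inj; rewrite pu -surjective_pairing.
Qed.

Let ps (k : 'I_n) := (k, k).

Let psi sym (x : 'rV[F]_(n + size s)) : 'rV[F]_#|{: low_pos n}| :=
  \row_v param_mx ps sym x (pos v).1 (pos v).2.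

Let lower_left x : forall i j : 'I_n, (i < j)%N -> @left_mx F n n s x i j = 0.
Proof.
move=> i j ij; have [_ l] := word_mx_lower (fun k => xcoord x (n + k)) red.
by have := l j i ij; rewrite mxE.
Qed.

Let diag_end (x : 'rV[F]_(n + size s)) : end_mx ps x = diag_mx (\row_i xcoord x i) :> 'M[F]_n.
Proof.
rewrite diag_mx_sum_delta; apply: eq_bigr => i _; by rewrite mxE.
Qed.

(** All variables sit on or below the diagonal, so [avoids_ess_card_low] bounds a standard support
    by n^2 - C(n, 2) - |D°(w)|, which is [n + size s]. *)
Lemma trdeg_le_triangular (G : 'M[{mpoly F[#|{: low_pos n}|]}]_n) :
  (forall v, G (pos v).1 (pos v).2 = 'X_v) ->
  (forall i j, G i j = 0 \/
     exists2 v, G i j = 'X_v & ((pos v).1 * (pos v).2 = i * j)%N) ->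
  trdeg_le (fulton_variety w G) (n + size s).
Proof.
move=> G1 G2; apply: (@trdeg_le_fulton _ _ _ _ _ pos) => // [V|a b].
  move/avoids_ess_card_low; rewrite card_dcirc card_imset //.
  have low p : p \in (pos @: V)%SET -> (p.2 <= p.1)%N by case/imsetP => v _ ->.
  have aux (v c b z : nat) : (z + c = b -> n * n = n + b + b -> v + c + b <= n * n -> v <= n + z)%N by lia.
  by move/(_ low); apply: aux ssz square_bin2.
exact: swrank_wmx.
Qed.

Lemma zdim_low : zdim (low_schubert F w) (n + size s).
Proof.
split; last first.
  move=> e T; apply: zchain_le; apply: trdeg_le_triangular.
    by move=> v; rewrite mxE low_var_pos.
  move=> i j; rewrite mxE; have [ji|ij] := leqP j i; last by left; rewrite low_var0.
  by right; have [v -> pv] := low_varP ji; exists v => //; rewrite pv.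
have low_param (x : 'rV[F]_(n + size s)) : forall i j : 'I_n, (i < j)%N -> param_mx ps false x i j = 0.
  move=> i j ij; rewrite /param_mx mulmx1 diag_end mul_mx_diag mxE.
  by rewrite lower_left // mul0r.
have psiK (x : 'rV[F]_(n + size s)) : eval_mx (generic_low F n) (psi false x) = param_mx ps false x.
  apply/matrixP => i j.
  have -> : eval_mx (generic_low F n) (psi false x) i j =
      (low_var F i j).@[psi false x 0] by rewrite !mxE.
  have [ji|ij] := leqP j i; last by rewrite low_var0 // meval0 low_param.
  by have [v -> pv] := low_varP ji; rewrite mevalXU mxE pv.
apply: (param_zchain (ps := ps) (sym := false) _ _ _ red _ psiK) => //.
- by move=> k l [].
- by move=> i; exists i.
- by move=> v; exists (pos v) => x; rewrite mxE.
- exact: zclosed_fulton.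
- by move=> x hx; apply: bruhat_fulton; rewrite psiK -sw.
Qed.

Lemma zdim_sym : zdim (sym_schubert F w) (n + size s).
Proof.
split; last first.
  move=> e T; apply: zchain_le; apply: trdeg_le_triangular.
    by move=> v; rewrite mxE pos_low low_var_pos.
  move=> i j; rewrite mxE; right; have [ji|ij] := leqP j i.
    by have [v -> pv] := low_varP ji; exists v => //; rewrite pv.
  by have [v -> pv] := low_varP (ltnW ij); exists v => //; rewrite pv mulnC.
(* With a diagonal middle factor D, the product L D L^T is symmetric and so is a value of the
   generic symmetric matrix. *)
have sym_param (x : 'rV[F]_(n + size s)) : (param_mx ps true x)^T = param_mx ps true x.
  by rewrite /param_mx !trmx_mul trmxK diag_end tr_diag_mx mulmxA.
have psiK (x : 'rV[F]_(n + size s)) : eval_mx (generic_sym F n) (psi true x) = param_mx ps true x.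
  apply/matrixP => i j.
  have -> : eval_mx (generic_sym F n) (psi true x) i j =
      (if (j <= i)%N then low_var F i j else low_var F j i).@[psi true x 0] by rewrite !mxE.
  have [ji|ij] := leqP j i.
    by have [v -> pv] := low_varP ji; rewrite mevalXU mxE pv.
  have [v -> pv] := low_varP (ltnW ij); rewrite mevalXU mxE pv /=.
  by rewrite -[in RHS]sym_param [RHS]mxE.
apply: (param_zchain (ps := ps) (sym := true) _ _ _ red _ psiK) => //.
- by move=> k l [].
- by move=> i; exists i.
- by move=> v; exists (pos v) => x; rewrite mxE.
- exact: zclosed_fulton.
- by move=> x hx; apply: bruhat_fulton; rewrite psiK -sw.
Qed.

End Triangular.

Section Full.

Let G : 'M[{mpoly F[n * n]}]_n := \matrix_(i, j) 'X_(mxvec_index i j).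
Let pos (v : 'I_(n * n)) : 'I_n * 'I_n := enum_val (cast_ord (esym (mxvec_cast n n)) v).

Let posK v : mxvec_index (pos v).1 (pos v).2 = v.
Proof. by rewrite /mxvec_index -surjective_pairing enum_valK cast_ordKV. Qed.

Let pos_index i j : pos (mxvec_index i j) = (i, j).
Proof. by rewrite /pos /mxvec_index cast_ordK enum_rankK. Qed.

Let evalK M : eval_mx G (mxvec M) = M.
Proof. by apply/matrixP => i j; rewrite !mxE mevalXU mxvecE. Qed.

Let U : {set 'I_n * 'I_n} 
  := [set p : 'I_n * 'I_n | (p.1 <= p.2)%N]%SET.

Let card_U : #|U| = (n + 'C(n, 2))%N.
Proof.
have := cardsC (noninvs (1%g : 'S_n)); rewrite card_noninvs1 card_prod card_ord square_bin2.
suff -> : #|~: noninvs (1%g : 'S_n)| = #|U| by lia.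
have finj : injective (fun p : 'I_n * 'I_n => (p.2, p.1)) by move=> [a b] [a' b'] [-> ->].
rewrite -(card_imset _ finj); apply: eq_card => -[i j].
apply/imsetP/idP => [[[a b] + [-> ->]]|ij]; first by rewrite !inE /= !perm1 andbb -leqNgt.
by exists (j, i) => //; move: ij; rewrite !inE /= !perm1 andbb -leqNgt.
Qed.

(** The closure of B w B lies in the Fulton variety of the generic matrix, which gives the upper
    bound; the chain for the lower bound is built inside the closure, with the entries of U on and
    above the diagonal as free parameters. *)
Lemma zdim_full : zdim (matrix_schubert F w) (n + 'C(n, 2) + size s).
Proof.
split; last first.
  move=> e T; apply: zchain_le.
  apply: (@trdeg_le_sub _ _ _ (fulton_variety w G)).
    apply: zclosure_sub; first exact: zclosed_fulton.
    by move=> _ [M hM <-]; apply: bruhat_fulton; rewrite evalK.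
  apply: (@trdeg_le_fulton _ _ _ _ _ pos) => [v|i j|V|a b].
  - by rewrite mxE posK.
  - by right; exists (mxvec_index i j); rewrite ?mxE ?pos_index.
  - move/avoids_ess_card; have := cardsC (pos @: V)%SET.
    rewrite card_dcirc card_imset => [|u v uv]; last by rewrite -(posK u) uv posK.
    rewrite card_prod card_ord.
    have aux (v c b z u : nat) :
      (z + c = b -> n * n = n + b + b -> v + u = n * n -> c <= u -> v <= n + b + z)%N by lia.
    exact: aux ssz square_bin2.
  - exact: swrank_wmx.
rewrite -card_U; pose ps (k : 'I_#|U|) : 'I_n * 'I_n := enum_val k.
apply: (@param_zchain F n (n * n) G #|U| ps false _ _ _ s red
          (fun x => mxvec (param_mx ps false x))).
- exact: enum_val_inj.
- by move=> k; have := enum_valP k; rewrite inE.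
- move=> i; have iU : (i, i) \in U by rewrite inE /=.
  by exists (enum_rank_in iU (i, i)); rewrite /ps enum_rankK_in.
- by move=> v; exists (pos v) => x; rewrite -{1}(posK v) mxvecE.
- by move=> x; rewrite evalK.
- exact: zclosed_zclosure.
- by move=> x hx; apply: sub_zclosure; exists (param_mx ps false x) => //; rewrite -sw.
Qed.

End Full.

End Dimensions.

Theorem proposition5p3 (R : realType) (n : nat) (w : 'S_n) :
  exists dlow dsym d : nat,
    [/\ zdim (low_schubert R[i] w) dlow,
        zdim (sym_schubert R[i] w) dsym,
        zdim (matrix_schubert R[i] w) d,
        dlow = dsym
      & dsym%:Z = d%:Z - ('C(n, 2))%:Z].
Proof.
have [s [red sw ssz]] := reduced_word w.
exists (n + size s)%N, (n + size s)%N, (n + 'C(n, 2) + size s)%N; split=> //.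
- exact: zdim_low.
- exact: zdim_sym.
- exact: zdim_full.
- by rewrite addnAC [X in _ = X - _]PoszD addrK.
Qed.
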